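(* Let $q\geq 3$ be a prime power and let $S$ be a semi-resolving set in $\mathrm{PG}(2,q)$. Then $|S|\geq\min\{2q+q/4-3,\ \tau_2(\mathrm{PG}(2,q))-2\}$. If $q\geq 121$ is a square prime power, then $|S|\geq 2q+2\sqrt{q}$.
   Context: $\mathrm{PG}(2,q)$ is the Desarguesian projective plane of order $q$; its incidence graph is the bipartite graph on points and lines with adjacency given by incidence, with graph distance $d$. A set $S=\{P_1,\dots,P_n\}$ of points is a semi-resolving set if the ordered distance lists $(d(\ell,P_1),\dots,d(\ell,P_n))$ in the incidence graph are pairwise distinct for distinct lines $\ell$. A double blocking set is a set of points meeting every line in at least two points; $\tau_2(\Pi)$ denotes the size of a smallest double blocking set of the plane $\Pi$. *)

(* Defs.v *)
From HB Require Import structures.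
From mathcomp Require Import all_boot all_order all_algebra.

Set Implicit Arguments.
Unset Strict Implicit.
Unset Printing Implicit Defensive.

Import Order.TTheory GRing.Theory Num.Theory.

(* Distance in the graph with adjacency relation e: the least number of edges
   of a walk from x to y. Some shortest walk has fewer than #|T| edges, so the
   search is bounded; the value is #|T| when y is not reachable from x. *)
Definition walk_of_length (T : finType) (e : rel T) (x y : T) (n : nat) : bool :=
  [exists p : n.-tuple T, path e x p && (last x p == y)].

Definition graph_dist (T : finType) (e : rel T) (x y : T) : nat :=
  find (walk_of_length e x y) (iota 0 #|T|).

(* A subspace is encoded by a square matrix in canonical form, which makes the
   subspaces of a finite space a finite type. *)
Section VspaceFinite.
Import VectorInternalTheory.
Variables (F : finFieldType) (vT : vectType F).
HB.instance Definition _ := [Countable of {vspace vT} by <:].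
HB.instance Definition _ := [Finite of {vspace vT} by <:].
End VspaceFinite.

(* PG(2, #|F|): the points and lines are the subspaces of F^3 of vector space
   dimension 1 and 2, with inclusion as incidence. *)
Definition point (F : finFieldType) : Type :=
  {U : {vspace 'rV[F]_3} | \dim U == 1%N}.
HB.instance Definition _ (F : finFieldType) := SubFinite.on (point F).

Definition line (F : finFieldType) : Type :=
  {U : {vspace 'rV[F]_3} | \dim U == 2%N}.
HB.instance Definition _ (F : finFieldType) := SubFinite.on (line F).

Definition incident (F : finFieldType) (P : point F) (l : line F) : bool :=
  (val P <= val l)%VS.

Definition incidence_graph (F : finFieldType) : rel (point F + line F) :=
  fun u v => match u, v with
             | inl P, inr l => incident P l
             | inr l, inl P => incident P l
             | _, _ => false
             end.

Definition dist_line_point (F : finFieldType) (l : line F) (P : point F) : nat :=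
  graph_dist (@incidence_graph F) (inr l) (inl P).

Definition dist_list (F : finFieldType) (S : {set point F}) (l : line F) : seq nat :=
  [seq dist_line_point l P | P <- enum S].

Definition semi_resolving (F : finFieldType) (S : {set point F}) : Prop :=
  injective (dist_list S).

Definition double_blocking (F : finFieldType) (B : {set point F}) : bool :=
  [forall l : line F, 2 <= #|[set P in B | incident P l]|].

Lemma double_blockingT (F : finFieldType) : double_blocking [set: point F].
Proof.
apply/forallP => -[U dU]; have /andP[_ fU] := vbasisP U.
have sz : size (vbasis U) = 2%N by rewrite size_tuple (eqP dU).
have d1 (i : nat) : i < 2 -> \dim <[(vbasis U)`_i]> == 1%N.
  move=> i2; rewrite dim_vline (free_not0 (X := vbasis U)) //.
  by rewrite mem_nth ?sz.
pose P0 : point F := exist _ <[(vbasis U)`_0]>%VS (d1 0%N isT);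
pose P1 : point F := exist _ <[(vbasis U)`_1]>%VS (d1 1%N isT).
have nP : P0 != P1.
  apply: contraL fU => /eqP/(congr1 val) /= e01.
  case: (tval (vbasis U)) sz e01 => [|a [|b [|]]] //= _ e01.
  by rewrite free_cons span_seq1 -e01 memv_line.
have sub : [set P0; P1] \subset
    [set P in [set: point F] | incident P (exist _ U dU : line F)].
  apply/subsetP => P; rewrite !inE => /orP[] /eqP ->; rewrite /incident /= -memvE;
  by apply: vbasis_mem; rewrite mem_nth ?sz.
by have := subset_leq_card sub; rewrite cards2 nP.
Qed.

(* The minimum ranges over a nonempty family, by double_blockingT. *)
Definition tau2 (F : finFieldType) : nat :=
  #|[arg min_(B < [set: point F] | double_blocking B) #|B|]|.

(* Main.v *)
(* A line is determined by its trace on a semi-resolving set S, so S has at most one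
   skew line and at most one tangent at each of its points.  Count tangents once and
   skew lines twice: the total t is at most |S| + 2.  If a point P outside S has
   index i (the part of t on lines through P), comparing the numbers of common roots of the Redei polynomial of S and
   of (X^q - X)^2 along a secant through P, by way of a Sylvester-type determinant,
   gives 3 q i <= t + i (i + |S|).  When |S| < 2q + q/4 - 3 every index is therefore
   at most 2 or at least 3q - |S| - 2, and adding at most two points turns S into
   a double blocking set.

   For q = r^2 it remains to see that a minimal double blocking set B has at least
   2q + 2r + 2 points.  Put |B| = 2q + 2 + c with c < 2r.  Through every point P of B
   there are at least two 2-secants; taking one of them as the line at infinity, the
   Redei polynomial yields a fully reducible polynomial X^q f1 + f0 with deg f1 = c
   and deg f0 <= c + 1, whose root multiplicities are |l \cap B| - 2 for the other
   lines l through P.  It is d h^r with h of degree r + 1 and simple roots, so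
   exactly r + 1 lines through P are long (at least r + 2 points of B) and none has
   more than c + 2 points.  The points outside B see a total excess c < 2r, so
   any two long lines meet in B.  Hence all long lines have the same number n of
   points and there are 1 + n r of them, which contradicts the incidence count. *)

Require Import Defs.
From mathcomp Require Import all_boot all_order all_algebra.
From mathcomp Require Import all_fingroup all_solvable all_field.
From mathcomp Require Import zify ring lra.
Set Implicit Arguments. Unset Strict Implicit. Unset Printing Implicit Defensive.
Import Order.TTheory GRing.Theory Num.Theory.
Local Open Scope ring_scope.

(** * Polynomials and determinants *)

Lemma dvdp_prod_seq (F : fieldType) (I : Type) (s : seq I) (P Q : I -> {poly F}) :
  (forall i, P i %| Q i) -> \prod_(i <- s) P i %| \prod_(i <- s) Q i.
Proof.
move=> PQ; elim/big_rec2: _ => [|i p q _ pq]; [exact: dvdpp | exact: dvdp_mul].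
Qed.

(** An invertible constant matrix [L] brings the matrix specialised at [y] to a form whose last
    [N - r] rows vanish. In [L *m M] these rows are therefore divisible by ['X - y%:P], and each
    contributes one factor to the determinant. *)
Lemma dvdp_det_corank (F : fieldType) N (M : 'M[{poly F}]_N) (y : F) :
  ('X - y%:P) ^+ (N - \rank (map_mx (horner_eval y) M)) %| \det M.
Proof.
set My := map_mx _ M; set r := \rank My; set L := invmx (col_ebase My).
have uL : L \in unitmx by rewrite unitmx_inv col_ebase_unit.
pose M' := map_mx polyC L *m M.
have M'0 (i j : 'I_N) : (r <= i)%N -> 'X - y%:P %| M' i j.
  move=> ri; rewrite dvdp_XsubCl /root.
  have -> : (M' i j).[y] = (L *m My) i j.
    rewrite !mxE horner_sum; apply: eq_bigr => k _.
    by rewrite !mxE hornerM hornerC.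
  rewrite -(mulmx_ebase My) /L !mulmxA mulVmx ?col_ebase_unit // mul1mx mxE.
  by rewrite big1 // => k _; rewrite mxE (ltnNge i) ri andbF mul0r.
have dM' : \det M' = (\det L)%:P * \det M by rewrite det_mulmx det_map_mx.
have nL : \det L != 0 by rewrite -unitfE -unitmxE.
rewrite -(dvdpZr _ _ nL) -mul_polyC -dM'.
apply: (big_ind (fun p => _ %| p)) => [|p p'|s _]; first exact: dvdp0.
  exact: dvdp_add.
apply: dvdp_mull.
have -> : ('X - y%:P) ^+ (N - r) =
    \prod_(i < N) (if (r <= i)%N then 'X - y%:P else 1).
  rewrite -big_mkcond /= prodr_const; congr (_ ^+ _).
  rewrite -sum1_card -(big_mkord (fun i => (r <= i)%N) (fun=> 1%N)).
  rewrite (big_cat_nat (n := r)) ?rank_leq_row //= big_nat_cond big1 ?add0n; last first.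
    by move=> i /andP[/andP[_ +]]; rewrite ltnNge => /negPf->.
  rewrite big_nat_cond (eq_bigl (fun i => (r <= i < N)%N && true)) => [|i].
    by rewrite -big_nat_cond sum_nat_const_nat muln1.
  by case: (r <= i)%N; rewrite /= ?andbT ?andbF.
by apply: dvdp_prod_seq => i; case: ifP => [/M'0//|_]; rewrite dvd1p.
Qed.

(** The entry in row [i] and column [j] has degree at most [r i - c j]. Each term of the Leibniz
    expansion uses every row and every column once, so all terms obey the same bound. *)
Lemma size_det_le (F : fieldType) N (M : 'M[{poly F}]_N) (r c : 'I_N -> nat) D :
  (forall i j, M i j != 0 -> (size (M i j) + c j <= (r i).+1)%N) ->
  (\sum_i r i <= D + \sum_i c i)%N -> (size (\det M) <= D.+1)%N.
Proof.
move=> szM rcD; apply: leq_trans (size_sum _ _ _) _; apply/bigmax_leqP => s _.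
rewrite mulr_sign.
have -> (b : bool) (p : {poly F}) : size (if b then - p else p) = size p.
  by case: b; rewrite ?size_polyN.
have [->|nz] := eqVneq (\prod_i M i (s i)) 0; first by rewrite size_poly0.
have nzi i : M i (s i) != 0 by move/prodf_neq0: nz; apply.
rewrite size_prod // leq_subLR cardT size_enum_ord addnS ltnS.
suff : (\sum_i size (M i (s i)) + \sum_i c i <= \sum_i r i + N)%N.
  by move: rcD; move: (\sum_i c i)%N (\sum_i r i)%N (\sum_i size _)%N; lia.
have -> : (\sum_i c i = \sum_i c (s i))%N by rewrite (reindex_inj (@perm_inj _ s)).
rewrite -big_split /= -[X in (_ + X)%N](card_ord N) -sum1_card -big_split /=.
by apply: leq_sum => i _; rewrite addn1 szM.
Qed.

Lemma prod_XsubC_exp_dvdp (F : finFieldType) (p : {poly F}) (k : F -> nat) :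
  (forall y, ('X - y%:P) ^+ k y %| p) -> \prod_y ('X - y%:P) ^+ k y %| p.
Proof.
move=> dvd; rewrite -big_enum /=; elim: (enum _) (enum_uniq F) => [|y s IH] /=.
  by rewrite big_nil dvd1p.
case/andP=> ys /IH {}IH; rewrite big_cons Gauss_dvdp ?dvd ?IH //.
apply/coprimep_expl; rewrite coprimep_sym coprimep_XsubC.
elim: s ys {IH} => [|z s IH]; first by rewrite big_nil rootE hornerC oner_eq0.
rewrite inE negb_or big_cons rootM negb_or => /andP[yz /IH->]; rewrite andbT.
by rewrite rootE horner_exp hornerXsubC expf_neq0 // subr_eq0.
Qed.

Lemma prod_XsubC_exp_monic (F : finFieldType) (k : F -> nat) :
  \prod_y ('X - y%:P) ^+ k y \is monic.
Proof. by apply: monic_prod => y _; apply: monic_exp; apply: monicXsubC. Qed.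

Lemma size_prod_XsubC_exp (F : finFieldType) (k : F -> nat) :
  size (\prod_y ('X - y%:P) ^+ k y) = (\sum_y k y).+1.
Proof.
rewrite size_prod => [|y _]; last by rewrite expf_neq0 ?polyXsubC_eq0.
under eq_bigr do rewrite size_exp_XsubC -addn1.
by rewrite big_split sum1_card -addSn addnK.
Qed.

Lemma mup_prod_XsubC_exp (F : finFieldType) (k : F -> nat) x :
  mup x (\prod_y ('X - y%:P) ^+ k y) = k x.
Proof.
rewrite (bigD1 x) //= mupMl ?mup_XsubCX ?eqxx //.
apply/negP => /rootP; rewrite horner_prod => /eqP/prodf_eq0[y yx].
by rewrite horner_exp hornerXsubC expf_eq0 subr_eq0 eq_sym (negPf yx) andbF.
Qed.

(** * Products of linear forms and the Redei polynomial *)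

Section LineProd.
Variable F : finFieldType.

Definition affine_prod (s : seq (F * F)) : {poly F} :=
  \prod_(t <- s) (t.1 *: 'X + t.2%:P).

(** A factor [z 'X + w] with [z = 0] is a nonzero constant; any other factor has the single root
    [- w / z]. *)
Lemma affine_prodE (s : seq (F * F)) : (0, 0) \notin s ->
  exists2 k, k != 0 &
    affine_prod s = k *: \prod_b ('X - b%:P) ^+ count (fun t => t.1 * b + t.2 == 0) s.
Proof.
elim: s => [|[z w] s IH]; rewrite /affine_prod.
  by exists 1; rewrite ?oner_eq0 // big_nil scale1r big1.
rewrite inE negb_or big_cons => /andP[zw /IH[k k0 E]].
rewrite [X in _ * X]E /=; have [z0|z0] := eqVneq z 0.
  have w0 : w != 0 by apply: contraNneq zw => ->; rewrite z0.
  exists (w * k); rewrite ?mulf_neq0 // z0 scale0r add0r mul_polyC scalerA.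
  by congr (_ *: _); apply: eq_bigr => b _; rewrite mul0r add0r (negPf w0).
exists (z * k); rewrite ?mulf_neq0 //.
have -> : z *: 'X + w%:P = z *: ('X - (- (w / z))%:P).
  by rewrite polyCN opprK scalerDr -[_ *: _%:P]mul_polyC -polyCM mulrCA mulfV ?mulr1.
rewrite -scalerAr -scalerAl scalerA [k * z]mulrC; congr (_ *: _).
rewrite (bigD1 (- (w / z))) //= [in RHS](bigD1 (- (w / z))) //= mulrA; congr (_ * _).
  by rewrite mulrN mulrCA mulfV ?mulr1 // addNr eqxx exprS.
apply: eq_bigr => b bn; rewrite -[z * b + w == 0]negbK.
suff -> : z * b + w != 0 by [].
apply: contraNneq bn => /eqP; rewrite addr_eq0 => /eqP E'.
by apply/eqP; rewrite -mulNr -E' mulrC mulKf.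
Qed.

Lemma size_affine_prod s : (size (affine_prod s) <= (size s).+1)%N.
Proof.
elim: s => [|t s IH]; first by rewrite /affine_prod big_nil size_poly1.
rewrite /affine_prod big_cons; apply: leq_trans (size_polyMleq _ _) _.
have : (size (t.1 *: 'X + t.2%:P)%R <= 2)%N.
  apply: leq_trans (size_polyD _ _) _; rewrite geq_max.
  by rewrite (leq_trans (size_scale_leq _ _)) ?size_polyX //= (leq_trans (size_polyC_leq1 _)).
rewrite /= -/(affine_prod s); move: (size _) (size (affine_prod s)) IH; lia.
Qed.

(** The Redei polynomial of points [(x : y : z)]. The outer variable is the intercept [b] and the
    inner one the slope [m]: a factor evaluates to [m x - y + b z]. *)
Definition line_prod (s : seq (F * F * F)) : {poly {poly F}} :=
  \prod_(t <- s) (t.2%:P *: 'X + (t.1.1 *: 'X - t.1.2%:P)%:P).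

Lemma line_prod_eval s m :
  map_poly (horner_eval m) (line_prod s) =
  affine_prod [seq (t.2, t.1.1 * m - t.1.2) | t <- s].
Proof.
rewrite /affine_prod big_map rmorph_prod; apply: eq_bigr => t _ /=.
rewrite rmorphD /= map_polyZ map_polyX map_polyC /= !/(horner_eval _ _).
by rewrite hornerC !hornerE.
Qed.

Lemma coef_line_prod_cons t s k :
  (line_prod (t :: s))`_k = (if k is k'.+1 then t.2 *: (line_prod s)`_k' else 0)
     + (t.1.1 *: 'X - t.1.2%:P) * (line_prod s)`_k.
Proof.
rewrite /line_prod big_cons mulrDl coefD coefCM -scalerAl coefZ coefXM.
by case: k => [|k] /=; rewrite ?mulr0 // mul_polyC.
Qed.

(** Each factor has total degree at most one in the two variables. *)
Lemma size_coef_line_prod s k : (size ((line_prod s)`_k)%R <= (size s).+1 - k)%N.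
Proof.
elim: s k => [|t s IH] k.
  by rewrite /line_prod big_nil coef1; case: k => [|k]; rewrite ?size_poly1 ?size_poly0.
rewrite coef_line_prod_cons; apply: leq_trans (size_polyD _ _) _; rewrite geq_max /=.
apply/andP; split; first by case: k => [|k]; rewrite ?size_poly0 // (leq_trans (size_scale_leq _ _)).
have [->|nz] := eqVneq (line_prod s)`_k 0; first by rewrite mulr0 size_poly0.
have := IH k; rewrite -size_poly_gt0 in nz => szk.
apply: leq_trans (size_polyMleq _ _) _.
have : (size (t.1.1 *: 'X - t.1.2%:P)%R <= 2)%N.
  apply: leq_trans (size_polyD _ _) _; rewrite geq_max size_polyN.
  by rewrite (leq_trans (size_scale_leq _ _)) ?size_polyX //= (leq_trans (size_polyC_leq1 _)).
by move: (size _) (size _) nz szk => a b; lia.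
Qed.

(** In the part of total degree [size s] the terms [y] disappear; what remains is the product of the
    [z 'X + x], homogenised by the inner variable. *)
Lemma coef_line_prod_top s k : (k <= size s)%N ->
  (line_prod s)`_k`_(size s - k) = (affine_prod [seq (t.2, t.1.1) | t <- s])`_k.
Proof.
elim: s k => [|t s IH] k.
  by rewrite /line_prod /affine_prod !big_nil; case: k => // _; rewrite !coef1.
move=> ks; rewrite coef_line_prod_cons coefD.
have -> : affine_prod [seq (t.2, t.1.1) | t <- t :: s] =
    (t.2 *: 'X + t.1.1%:P) * affine_prod [seq (t.2, t.1.1) | t <- s].
  by rewrite /affine_prod /= big_cons.
rewrite [in RHS]mulrDl [in RHS]coefD -[in RHS]scalerAl [in RHS]coefZ [in RHS]coefXM [in RHS]coefCM.
congr (_ + _).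
  case: k ks => [|k] ks; first by rewrite coef0 mulr0.
  by rewrite coefZ subSS IH.
move: ks; rewrite leq_eqVlt => /orP[/eqP->|ks].
  have := size_coef_line_prod s (size s).+1; rewrite subnn leqn0 size_poly_eq0 => /eqP->.
  rewrite mulr0 coef0 nth_default ?mulr0 //.
  apply: leq_trans (size_affine_prod _) _; by rewrite size_map.
rewrite ltnS in ks.
have top0 : (line_prod s)`_k`_(size s - k).+1 = 0.
  by apply: nth_default; rewrite -subSn // size_coef_line_prod.
rewrite mulrBl coefB coefCM -scalerAl coefZ coefXM subSn //= top0 mulr0 subr0.
by rewrite (IH _ ks).
Qed.
End LineProd.

(** * Common divisors of specialisations *)

Section CommonDivisor.
Variables (F : finFieldType) (U : {poly {poly F}}) (v : {poly F}) (n d : nat).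
Variables (D : F -> {poly F}) (y0 : F).
Let u y : {poly F} := map_poly (horner_eval y) U.
Hypothesis szU : forall k, (size (U`_k)%R <= n.+1 - k)%N.
Hypothesis szv : size v = d.+1.
Hypothesis Du : forall y, D y %| u y.
Hypothesis Dv : forall y, D y %| v.
Hypothesis u0 : u y0 != 0.
Hypothesis cop : coprimep (u y0 %/ D y0) (v %/ D y0).

Let v0 : v != 0. Proof. by rewrite -size_poly_gt0 szv. Qed.
Let D0 y : D y != 0. Proof. by apply: contraNneq v0 => E; have := Dv y; rewrite E dvd0p. Qed.
Let k y := (size (D y)).-1.
Let szD y : size (D y) = (k y).+1.
Proof. by rewrite /k prednK // size_poly_gt0. Qed.
Let szu y : (size (u y) <= n.+1)%N.
Proof.
apply/leq_sizeP => j nj; rewrite coef_map /= /horner_eval.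
suff -> : U`_j = 0 by rewrite horner0.
by apply/eqP; rewrite -size_poly_leq0; apply: leq_trans (szU j) _; lia.
Qed.
Let k_d y : (k y <= d)%N.
Proof. by have := dvdp_leq v0 (Dv y); rewrite szD szv. Qed.
Let k0_n : (k y0 <= n)%N.
Proof. by have := leq_trans (dvdp_leq u0 (Du y0)) (szu y0); rewrite szD. Qed.

Local Notation A := (d - k y0)%N.
Local Notation B := (n - k y0)%N.

(* Row i < A represents 'X^i * U and row A + j represents 'X^j * v; the columns
   record the coefficients of 'X^(k y0) and above. *)
Let row_poly (i : nat) : {poly {poly F}} :=
  if (i < A)%N then 'X^i * U else 'X^(i - A) * map_poly polyC v.
Let M : 'M[{poly F}]_(A + B) := \matrix_(i, c) (row_poly i)`_(k y0 + c).
Let My y := map_mx (horner_eval y) M.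

Let comb y (w : 'rV[F]_(A + B)) : {poly F} :=
  rVpoly (lsubmx w) * u y + rVpoly (rsubmx w) * v.

Let mul_My y w c : (w *m My y) 0 c = (comb y w)`_(k y0 + c).
Proof.
have ev i : (My y) i c = ((if (i < A)%N then 'X^i * u y else 'X^(i - A) * v))`_(k y0 + c).
  rewrite !mxE -[horner_eval y _](coef_map (horner_eval y)) /row_poly.
  case: ifP => _; rewrite rmorphM /= map_polyXn //.
  rewrite -map_poly_comp map_poly_id // => a _ /=; exact: hornerC.
rewrite mxE big_split_ord /comb coefD; congr (_ + _).
  rewrite [rVpoly _]poly_def mulr_suml coef_sum; apply: eq_bigr => i _.
  by rewrite insubT ?ltn_ord //= => H; rewrite ev /= ltn_ord -scalerAl coefZ mxE; congr (w _ _ * _); apply: val_inj.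
rewrite [rVpoly _]poly_def mulr_suml coef_sum; apply: eq_bigr => i _.
rewrite insubT ?ltn_ord //= => H; rewrite ev /= ltnNge leq_addr /= addKn -scalerAl coefZ mxE.
by congr (w _ _ * _); apply: val_inj.
Qed.

Let size_comb y w : (size (comb y w) <= k y0 + (A + B))%N.
Proof.
have kd := k_d y0; rewrite /comb; apply: leq_trans (size_polyD _ _) _.
rewrite geq_max; apply/andP; split; apply: leq_trans (size_polyMleq _ _) _.
  have := size_poly A (fun i => if insub i is Some i then lsubmx w 0 i else 0).
  rewrite -[\poly_(_ < _) _]/(rVpoly _).
  by move: (size _) (size (u y)) (szu y) k0_n => *; lia.
rewrite szv; have := size_poly B (fun i => if insub i is Some i then rsubmx w 0 i else 0).
rewrite -[\poly_(_ < _) _]/(rVpoly _).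
by move: (size _) k0_n => *; lia.
Qed.

Let comb0 y w : w *m My y = 0 -> (size (comb y w) <= k y0)%N.
Proof.
move=> w0; apply/leq_sizeP => j kj.
have [jN|jN] := ltnP (j - k y0) (A + B).
  by have := mul_My y w (Ordinal jN); rewrite w0 mxE /= subnKC.
by rewrite nth_default // (leq_trans (size_comb y w)) //; lia.
Qed.

(** A left kernel vector gives a combination of [u y0] and [v] that is divisible by [D y0] but of
    smaller degree, hence zero. Coprimality of the cofactors and the degree bounds then make both
    coefficients vanish. *)
Let det_y0 : \det (My y0) != 0.
Proof.
rewrite -unitfE -unitmxE -row_free_unit -kermx_eq0.
apply/rowV0P => w /sub_kermxP/comb0 szc.
have Dc : D y0 %| comb y0 w.
  by apply: dvdp_add; apply: dvdp_mull.
have c0 : comb y0 w = 0.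
  apply: contraTeq szc => c0; rewrite -ltnNge.
  by have := dvdp_leq c0 Dc; rewrite szD.
pose a := rVpoly (lsubmx w); pose b := rVpoly (rsubmx w).
have E : a * (u y0 %/ D y0) + b * (v %/ D y0) = 0.
  apply: (mulIf (D0 y0)); rewrite mul0r mulrDl -!mulrA !divpK //; exact: c0.
have vD0 : v %/ D y0 != 0 by rewrite dvdp_div_eq0.
have a0 : a = 0.
  have da : v %/ D y0 %| a.
    rewrite -(Gauss_dvdpl a (q := u y0 %/ D y0)) 1?coprimep_sym //.
    by move/eqP: E; rewrite addr_eq0 => /eqP->; rewrite -mulNr dvdp_mull.
  apply/eqP; apply: contraTT (size_poly A (fun i => if insub i is Some i then lsubmx w 0 i else 0)) => a0.
  rewrite -ltnNge; apply: leq_trans (dvdp_leq a0 da).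
  by rewrite size_divp // szv szD; have := k_d y0; lia.
have b0 : b = 0.
  by move/eqP: E; rewrite a0 mul0r add0r mulf_eq0 (negPf vD0) orbF => /eqP.
rewrite -[w]hsubmxK -[lsubmx w]rVpolyK -[rsubmx w]rVpolyK.
by rewrite -/a -/b a0 b0 !linear0 row_mx0.
Qed.

Let det_M : \det M != 0.
Proof.
apply: contraNneq det_y0 => M0; rewrite /My det_map_mx M0 /= /horner_eval.
by rewrite horner0.
Qed.

(** The syzygies ['X^i * v1 * u y = 'X^i * u1 * v] with [i < k y - k y0] provide independent vectors
    in the left kernel. *)
Let rank_My y : (k y - k y0 <= A + B - \rank (My y))%N.
Proof.
set l := (k y - k y0)%N; case: (posnP l) => [->//|l0].
pose v1 := v %/ D y; pose u1 := u y %/ D y.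
have szv1 : (size v1 <= d.+1 - k y)%N by rewrite size_divp // szv szD.
have szu1 : (size u1 <= n.+1 - k y)%N.
  by rewrite size_divp // szD; have := szu y; rewrite /=; move: (size _); lia.
have szA (i : 'I_l) : (size ('X^i * v1)%R <= A)%N.
  apply: leq_trans (size_polyMleq _ _) _; rewrite size_polyXn.
  have := ltn_ord i; rewrite /l; have := k_d y; move: (size _) szv1; lia.
have szB (i : 'I_l) : (size (- ('X^i * u1))%R <= B)%N.
  rewrite size_polyN; have [->|] := eqVneq u1 0; first by rewrite mulr0 size_poly0.
  rewrite -size_poly_gt0 => u1_gt0; apply: leq_trans (size_polyMleq _ _) _.
  rewrite size_polyXn; have := ltn_ord i; rewrite /l; have := k0_n; move: u1_gt0; move: (size _) szu1; lia.
pose K : 'M[F]_(l, A + B) := \matrix_i row_mx (poly_rV ('X^i * v1)) (poly_rV (- ('X^i * u1))).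
have KM : K *m My y = 0.
  apply/row_matrixP => i; rewrite row_mul rowK row0; apply/rowP => c.
  rewrite mul_My /comb row_mxKl row_mxKr !poly_rV_K // mxE.
  rewrite mulNr -!mulrA [v1 * _]mulrC.
  have -> : u y * v1 = u1 * v by rewrite /u1 /v1 divp_mulA // [RHS]mulrC divp_mulA ?Du // mulrC.
  by rewrite subrr coef0.
have rK : row_free K.
  rewrite -kermx_eq0; apply/rowV0P => w /sub_kermxP wK.
  have E : rVpoly w * v1 = 0.
    have := congr1 lsubmx wK; rewrite linear0.
    have -> : lsubmx (w *m K) = poly_rV (rVpoly w * v1).
      rewrite [rVpoly w]poly_def mulr_suml linear_sum /= mulmx_sum_row linear_sum.
      apply: eq_bigr => i _; rewrite insubT ?ltn_ord //= => H.
      rewrite -scalerAl !linearZ /= rowK row_mxKl; congr (w _ _ *: _); exact: val_inj.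
    move/(congr1 rVpoly); rewrite linear0 poly_rV_K //.
    apply: leq_trans (size_polyMleq _ _) _.
    have := size_poly l (fun i => if insub i is Some i then w 0 i else 0).
    rewrite -[\poly_(_ < _) _]/(rVpoly _) /l; have := k_d y; move: (size _) (size _) szv1; lia.
  have v10 : v1 != 0 by rewrite dvdp_div_eq0.
  move/eqP: E; rewrite mulf_eq0 (negPf v10) orbF => /eqP E.
  by rewrite -[w]rVpolyK E linear0.
have := mulmx0_rank_max KM; rewrite (eqnP rK); lia.
Qed.

(** The determinant of [M] is a subresultant: it is nonzero at [y0], it vanishes at each [y] to
    order at least [k y - k y0], and its degree is at most the right-hand side. *)
Lemma sum_common_divisor_excess : (\sum_y (k y - k y0) <= (d - k y0) * (n - k y0))%N.
Proof.
have dvd : \prod_y ('X - y%:P) ^+ (k y - k y0) %| \det M.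
  apply: prod_XsubC_exp_dvdp => y; apply: dvdp_trans (dvdp_det_corank M y).
  by apply: dvdp_exp2l; exact: rank_My.
have := dvdp_leq det_M dvd; rewrite size_prod_XsubC_exp => /leq_trans lt.
rewrite -ltnS; apply: lt.
(* The coefficient of index [k y0 + c - i] of [U] has degree at most [n + i - (k y0 + c)]. The
   entries from [v] are constants, zero once [k y0 + c] exceeds [d + (i - A)]. Against the column
   weights the [B] rows of [v] cancel, and the [A] rows of [U] leave [A * B]. *)
pose r (i : 'I_(A + B)) := if (i < A)%N then (n + i)%N else (d + (i - A))%N.
apply: (size_det_le (r := r) (c := fun c => (k y0 + c)%N)) => [i c|].
  rewrite mxE /row_poly /r; case: ifP => _; rewrite coefXnM; case: ifP => [|/negbT H]; rewrite ?eqxx //.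
    rewrite -size_poly_gt0; have := szU (k y0 + c - i)%N.
    by move: (nat_of_ord c) (nat_of_ord i) H (size _) => *; lia.
  rewrite coef_map polyC_eq0 => vc.
  have := size_polyC_leq1 v`_(k y0 + c - (i - A)).
  have : (k y0 + c - (i - A) < d.+1)%N.
    by rewrite -szv ltnNge; apply: contra vc => /(nth_default 0)->.
  by move: (nat_of_ord c) (nat_of_ord i) H (size _) => *; lia.
rewrite !big_split_ord /= addnA -addnA [X in (_ <= X)%N]addnA; apply: leq_add.
  rewrite -[X in (X * _)%N](card_ord A) -sum_nat_const -big_split /=; apply: leq_sum => i _.
  by rewrite /r /= ltn_ord; have := k0_n; lia.
apply: leq_sum => i _; rewrite /r /= ltnNge leq_addr /= addKn; have := k_d y0; lia.
Qed.
End CommonDivisor.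

Lemma root_prod_XsubC_exp (F : finFieldType) (k : F -> nat) x :
  root (\prod_y ('X - y%:P) ^+ k y) x = (0 < k x)%N.
Proof.
rewrite -dvdp_XsubCl XsubC_dvd ?mup_prod_XsubC_exp //.
by rewrite monic_neq0 // prod_XsubC_exp_monic.
Qed.

Lemma coprimep_prod_XsubC_exp (F : finFieldType) (e f : F -> nat) :
  (forall b, (e b == 0%N) || (f b == 0%N)) ->
  coprimep (\prod_b ('X - b%:P) ^+ e b) (\prod_b ('X - b%:P) ^+ f b).
Proof.
move=> ef; apply: (big_ind (fun p => coprimep p _)) => [|p p' cp cp'|b _].
- exact: coprime1p.
- by rewrite coprimepMl cp.
have /orP[/eqP->|/eqP fb] := ef b; first by rewrite coprime1p.
by apply: coprimep_expl; rewrite coprimep_sym coprimep_XsubC root_prod_XsubC_exp fb.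
Qed.

(** * The index inequality for a point off the set *)

Section Index.
Variable F : finFieldType.
Implicit Types s : seq (F * F * F).

(* (x, y, z) stands for the point (x : y : z), counted when it lies on the line
   of equation m x - y + b z = 0. *)
Definition line_count s (m b : F) : nat :=
  count (fun t => t.2 * b + (t.1.1 * m - t.1.2) == 0) s.

Lemma line_prod_evalE s m : all (fun t => (t.2, t.1.1 * m - t.1.2) != (0, 0)) s ->
  exists2 k, k != 0 & map_poly (horner_eval m) (line_prod s) =
    k *: \prod_b ('X - b%:P) ^+ line_count s m b.
Proof.
move=> nz; rewrite line_prod_eval.
case: (affine_prodE (s := [seq (t.2, t.1.1 * m - t.1.2) | t <- s])) => [|k k0 ->].
  by apply/mapP => -[t /(allP nz) + E]; rewrite -E eqxx.
by exists k => //; congr (_ *: _); apply: eq_bigr => b _; rewrite count_map.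
Qed.

Lemma dvdp_line_prod_eval s m :
  \prod_b ('X - b%:P) ^+ line_count s m b %| map_poly (horner_eval m) (line_prod s).
Proof.
have [/line_prod_evalE[k k0 ->]|/allPn[t ts]] := boolP (all (fun t => (t.2, t.1.1 * m - t.1.2) != (0, 0)) s).
  by rewrite dvdpZr.
rewrite negbK => /eqP[z0 w0]; rewrite line_prod_eval /affine_prod big_map (big_rem t) //= z0 w0.
by rewrite scale0r add0r mul0r dvdp0.
Qed.

Definition line_index s (m b : F) : nat := 2 - line_count s m b.

(** The lines with [m = 0] pass through the point [(1 : 0 : 0)]. The common divisor of the Redei
    polynomial at [m] and of [('X^q - 'X) ^+ 2] has degree [2 q - i_m], with [i_m] the sum of the
    line indices for [m]. The subresultant bound at [m = 0] gives [q i_0 <= \sum_m i_m + i_0 (size s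
    + i_0 - 2 q)]. *)
Lemma index_bound s :
  all (fun t => (t.2, t.1.2) != (0, 0)) s ->
  (3 * #|F| * (\sum_b line_index s 0%R b) <=
     \sum_m \sum_b line_index s m b + (\sum_b line_index s 0%R b) * (\sum_b line_index s 0%R b + size s))%N.
Proof.
move=> nz; pose ind := line_index s.
rewrite -/ind.
pose v : {poly F} := \prod_b ('X - b%:P) ^+ 2.
pose D m : {poly F} := \prod_b ('X - b%:P) ^+ minn 2 (line_count s m b).
pose u m := map_poly (horner_eval m) (line_prod s).
have szv : size v = (2 * #|F|).+1 by rewrite size_prod_XsubC_exp sum_nat_const mulnC.
have vE m : v = \prod_b ('X - b%:P) ^+ ind m b * D m.
  rewrite -big_split /=; apply: eq_bigr => b _; rewrite -exprD; congr (_ ^+ _).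
  by rewrite /ind /line_index; lia.
have Du m : D m %| u m.
  apply: dvdp_trans (dvdp_line_prod_eval s m); apply: dvdp_prod_seq => b.
  by rewrite dvdp_exp2l // geq_minr.
have Dv m : D m %| v by rewrite (vE m) dvdp_mull.
have D0 m : D m != 0 by rewrite monic_neq0 // prod_XsubC_exp_monic.
have [k k0 uE] : exists2 k, k != 0 & u 0 = k *: \prod_b ('X - b%:P) ^+ line_count s 0 b.
  apply: line_prod_evalE; apply: sub_all nz => t.
  by rewrite mulr0 sub0r !xpair_eqE oppr_eq0.
have u0 : u 0 != 0.
  by rewrite uE scaler_eq0 negb_or k0 monic_neq0 // prod_XsubC_exp_monic.
have cop : coprimep (u 0 %/ D 0) (v %/ D 0).
  have -> : u 0 = k *: (\prod_b ('X - b%:P) ^+ (line_count s 0 b - 2)) * D 0.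
    rewrite uE -scalerAl -big_split /=; congr (_ *: _); apply: eq_bigr => b _.
    by rewrite -exprD; congr (_ ^+ _); lia.
  rewrite (vE 0) !mulpK // coprimepZl //; apply: coprimep_prod_XsubC_exp => b.
  by rewrite /ind /line_index; lia.
have := sum_common_divisor_excess (size_coef_line_prod s) szv Du Dv u0 cop.
have szD m : (size (D m)).-1 = (2 * #|F| - \sum_b ind m b)%N.
  rewrite size_prod_XsubC_exp /=.
  have : (\sum_b minn 2 (line_count s m b) + \sum_b ind m b = 2 * #|F|)%N.
    rewrite -big_split /= -[RHS]mulnC -sum_nat_const.
    by apply: eq_bigr => b _; rewrite /ind /line_index; lia.
  by move=> <-; rewrite addnK.
have i_le m : (\sum_b ind m b <= 2 * #|F|)%N.
  rewrite mulnC -sum_nat_const; apply: leq_sum => b _; rewrite /ind /line_index; lia.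
have ks : (2 * #|F| - \sum_b ind 0%R b <= size s)%N.
  rewrite -szD; have := dvdp_leq u0 (Du 0%R).
  have : (size (u 0%R) <= (size s).+1)%N.
    by rewrite /u line_prod_eval; apply: leq_trans (size_affine_prod _) _; rewrite size_map.
  by move: (size _) (size _) (size _) => *; lia.
under eq_bigr do rewrite !szD.
have lb : (#|F| * (\sum_b ind 0%R b) <= \sum_m \sum_b ind m b +
    \sum_m (2 * #|F| - \sum_b ind m b - (2 * #|F| - \sum_b ind 0%R b)))%N.
  rewrite -big_split /= -sum_nat_const; apply: leq_sum => m _; have := i_le m; have := i_le 0.
  by move: (\sum_b ind m b)%N (\sum_b ind 0%R b)%N #|F| => a b c; lia.
rewrite szD; move: lb ks (i_le 0).
move: (\sum_m (_ - _))%N (\sum_m \sum_b ind m b)%N => X Y.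
move: (\sum_b ind 0%R b)%N (size s) #|F| => i n q lb ks iq.
have -> : (2 * q - (2 * q - i) = i)%N by lia.
have -> : (n - (2 * q - i) = n + i - 2 * q)%N by lia.
move=> ub; have := leq_trans lb (leq_add (leqnn _) ub).
rewrite mulnBr; nia.
Qed.
End Index.

(** * Lacunary polynomials *)

Section Lacunary.
Variable F : finFieldType.
Local Notation q := #|F|.
Implicit Types s : seq (F * F * F).

Lemma prod_XsubC_sqr : \prod_(b : F) ('X - b%:P) ^+ 2 = ('X^q - 'X) ^+ 2 :> {poly F}.
Proof. by rewrite prodrXl finField_genPoly. Qed.

Lemma coef_mul_lacunary (A : {poly F}) k :
  (A * ('X^q - 'X) ^+ 2)`_k =
    (if (k < 2 * q)%N then 0 else A`_(k - 2 * q))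
    - (if (k < q.+1)%N then 0 else A`_(k - q.+1)) *+ 2 + (if (k < 2)%N then 0 else A`_(k - 2)).
Proof.
have -> : A * ('X^q - 'X) ^+ 2 = A * 'X^(2 * q) - (A * 'X^(q.+1)) *+ 2 + A * 'X^2.
  by rewrite sqrrB mulrDr mulrBr mulrnAr -exprM -exprSr mulnC.
by rewrite coefD coefB coefMn !coefMXn.
Qed.

Lemma line_prod_coef_eval s k m :
  ((line_prod s)`_k).[m] = (map_poly (horner_eval m) (line_prod s))`_k.
Proof. by rewrite coef_map. Qed.

Lemma size_line_prod_eval s m : (size (map_poly (horner_eval m) (line_prod s)) <= (size s).+1)%N.
Proof. by rewrite line_prod_eval (leq_trans (size_affine_prod _)) ?size_map. Qed.

Lemma double_line_prod_eval s m : (forall b, 2 <= line_count s m b)%N ->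
  exists2 A : {poly F}, map_poly (horner_eval m) (line_prod s) = A * ('X^q - 'X) ^+ 2 &
    size A = (size (map_poly (horner_eval m) (line_prod s)) - 2 * q)%N.
Proof.
move=> dbl; set u := map_poly _ _.
have /dvdpP[A uE] : ('X^q - 'X) ^+ 2 %| u.
  rewrite -prod_XsubC_sqr; apply: dvdp_trans (dvdp_line_prod_eval s m).
  by apply: dvdp_prod_seq => b; apply: dvdp_exp2l; apply: dbl.
exists A => //; have [A0|A0] := eqVneq A 0; first by rewrite uE A0 mul0r size_poly0.
rewrite uE -prod_XsubC_sqr size_Mmonic ?prod_XsubC_exp_monic //.
by rewrite size_prod_XsubC_exp sum_nat_const addnS /= mulnC addnK.
Qed.

(* The coefficient of 'X^(2 * q - 1) is a polynomial in m of degree at most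
   size s - 2 * q + 1; it vanishes at every m except 0. *)
Lemma single_tangent_size s : (1 < q)%N ->
  all (fun t => (t.2, t.1.2) != (0, 0)) s ->
  (forall m b : F, (m, b) != (0, 0)%R -> 2 <= line_count s m b)%N ->
  line_count s 0%R 0%R = 1%N -> (3 * q <= size s + 2)%N.
Proof.
move=> q1 nz dbl one; rewrite leqNgt; apply/negP => lt.
pose P := (line_prod s)`_(2 * q).-1.
have szP : (size P <= q.-1)%N.
  by apply: leq_trans (size_coef_line_prod _ _) _; lia.
have rootP m : m != 0 -> root P m.
  move=> m0; rewrite rootE line_prod_coef_eval.
  have [b|A EA szA] := @double_line_prod_eval s m _.
    by apply: dbl; rewrite xpair_eqE (negPf m0).
  (* The coefficient of ['X^(2 * q - 1)] involves [A] only at the indices [q - 2] and [2 * q - 3],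
     both beyond its degree. *)
  have sA : (size A <= q - 2)%N.
    rewrite szA; have := size_line_prod_eval s m.
    by move: (size (map_poly _ _)) (size s) q lt; lia.
  have Az j : (q <= j + 2)%N -> A`_j = 0.
    by move=> qj; apply: nth_default; apply: leq_trans sA _; lia.
  have -> : ((map_poly (horner_eval m) (line_prod s))`_(2 * q).-1 == 0) = (0 == 0 :> F).
    rewrite EA coef_mul_lacunary ifT; last by lia.
    by rewrite !Az ?if_same ?mul0rn ?subr0 ?addr0 //; lia.
  exact: eqxx.
have [k k0 uE] : exists2 k, k != 0 & map_poly (horner_eval 0) (line_prod s) =
    k *: \prod_b ('X - b%:P) ^+ line_count s 0 b.
  apply: line_prod_evalE; apply: sub_all nz => t.
  by rewrite mulr0 sub0r !xpair_eqE oppr_eq0.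
have P0 : P.[0] != 0.
  rewrite line_prod_coef_eval uE coefZ mulf_neq0 //.
  (* At [m = 0] the root [0] is simple, so one more factor ['X] is needed for divisibility by
     [('X^q - 'X) ^+ 2]. The coefficient sought becomes that of ['X^(2 * q)], which is the nonzero
     constant term of [A]. *)
  pose A : {poly F} := \prod_(b | b != 0) ('X - b%:P) ^+ (line_count s 0 b - 2).
  have AE : 'X * \prod_b ('X - b%:P) ^+ line_count s 0 b = A * ('X^q - 'X) ^+ 2.
    rewrite -prod_XsubC_sqr (bigD1 0) //= [in RHS](bigD1 0) //= one.
    rewrite [RHS]mulrCA -big_split /= subr0 expr1 mulrA -expr2; congr (_ * _).
    apply: eq_bigr => b b0; rewrite -exprD subnK //.
    by apply: dbl; rewrite xpair_eqE (negPf b0) andbF.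
  have <- : ('X * \prod_b ('X - b%:P) ^+ line_count s 0 b)`_(2 * q) =
      (\prod_b ('X - b%:P) ^+ line_count s 0 b)`_(2 * q).-1.
    by rewrite coefXM; case: ifP => // /eqP; lia.
  have A0 : A != 0 by apply/prodf_neq0 => b _; rewrite expf_neq0 ?polyXsubC_eq0.
  have sA : (size A <= q - 1)%N.
    have := congr1 (fun p : {poly F} => size p) AE.
    rewrite size_Mmonic // -?prod_XsubC_sqr ?prod_XsubC_exp_monic //.
    rewrite mulrC size_mulX ?monic_neq0 ?prod_XsubC_exp_monic //.
    rewrite !size_prod_XsubC_exp sum_nat_const addnS /=.
    have := size_line_prod_eval s 0; rewrite uE size_scale // size_prod_XsubC_exp.
    by move: (\sum_b _)%N (size A) (size s) q lt; clear; lia.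
  rewrite AE coef_mul_lacunary ltnn subnn.
  rewrite [X in _ - (if _ then _ else X) *+ _ + _]nth_default; last by apply: leq_trans sA _; lia.
  rewrite [X in _ - _ + (if _ then _ else X)]nth_default; last by apply: leq_trans sA _; lia.
  rewrite !if_same mul0rn subr0 addr0 -horner_coef0 horner_prod.
  apply/prodf_neq0 => b b0; rewrite horner_exp hornerXsubC expf_neq0 //.
  by rewrite sub0r oppr_eq0.
have Pn0 : P != 0 by apply: contraNneq P0 => ->; rewrite horner0.
have := max_poly_roots Pn0 (rs := enum (predC1 (0 : F))) _ (enum_uniq _).
rewrite -cardE cardC1 ltnNge szP => H; suff : false by [].
by apply: H; apply/allP => m; rewrite mem_enum => /rootP.
Qed.

(* The number of points on the line of equation x + b z = 0 through (0 : 1 : 0). *)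
Definition pencil_count s (b : F) : nat := count (fun t => t.2 * b + t.1.1 == 0) s.

Lemma sum_pencil_count s : all (fun t => (t.2, t.1.1) != (0, 0)) s ->
  (\sum_b pencil_count s b = count (fun t => t.2 != 0%R) s)%N.
Proof.
elim: s => [|[[x y] z] s IH] /=; first by rewrite big1.
case/andP=> nz /IH <-; rewrite big_split /=; congr (_ + _)%N.
have [z0|z0] := eqVneq z 0.
  rewrite big1 // => b _; move: nz; rewrite z0 mul0r add0r xpair_eqE eqxx /=.
  by move/negPf->.
rewrite (bigD1 (- (x / z))) //= big1 => [|b bn].
  by rewrite mulrN mulrCA mulfV // mulr1 addNr eqxx.
apply/eqP; rewrite eqb0; apply: contraNneq bn => /eqP; rewrite addr_eq0 => /eqP E.
by apply/eqP; rewrite -mulNr -E mulrC mulKf.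
Qed.

(* For q + c + 2 <= j < 2 * q the coefficient of 'X^j in [line_prod s] is a polynomial
   of degree less than q vanishing on F, hence 0; its top coefficient is the
   coefficient of 'X^j in the product of the z 'X + x. *)
Lemma pencil_lacunary s c :
  all (fun t => (t.2, t.1.1) != (0, 0)) s ->
  (forall m b, 2 <= line_count s m b)%N -> (forall b, 0 < pencil_count s b)%N ->
  count (fun t => t.2 == 0) s = 1%N -> size s = (2 * q + c).+1 -> (c + 2 < q)%N ->
  (\sum_b (pencil_count s b).-1 = q + c)%N /\
  exists f1 f0 : {poly F}, [/\ \prod_b ('X - b%:P) ^+ (pencil_count s b).-1 = 'X^q * f1 + f0,
    (size f1 <= c.+1)%N & (size f0 <= c.+2)%N].
Proof.
move=> nz dbl pos one szs cq.
have sum_pc : (\sum_b pencil_count s b = 2 * q + c)%N.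
  rewrite sum_pencil_count //; apply/eqP; rewrite -eqSS -szs.
  by rewrite -(count_predC (fun t => t.2 == 0) s) one.
have sum_g : (\sum_b (pencil_count s b).-1 = q + c)%N.
  have : (\sum_b (pencil_count s b).-1 + q = 2 * q + c)%N.
    rewrite -sum_pc -sum1_card -big_split /=; apply: eq_bigr => b _.
    by rewrite addn1 prednK.
  by move: (\sum_b _)%N q; clear; lia.
split=> //; set g := \prod_b _.
have szg : size g = (q + c).+1 by rewrite size_prod_XsubC_exp sum_g.
pose f := affine_prod [seq (t.2, t.1.1) | t <- s].
have [k k0 fE] : exists2 k, k != 0 & f = k *: (g * ('X^q - 'X)).
  case: (affine_prodE (s := [seq (t.2, t.1.1) | t <- s])) => [|k k0 fE].
    by apply/mapP => -[t /(allP nz) + E]; rewrite -E eqxx.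
  exists k => //; rewrite /f fE finField_genPoly -big_split; congr (_ *: _).
  by apply: eq_bigr => b _; rewrite /= -exprSr prednK ?pos // count_map.
(* The one point with [z = 0] lowers the degree of [f] to [2 q + c], below [size s]; this saves one
   degree in every specialisation and bounds the degree of each [A] below by [c]. *)
have Ln : (line_prod s)`_(size s) = 0.
  have := size_coef_line_prod s (size s); rewrite subSnn => /size1_polyC->.
  apply/eqP; rewrite polyC_eq0 -[X in _`_X](subnn (size s)) coef_line_prod_top //.
  rewrite -/f fE coefZ nth_default ?mulr0 //.
  rewrite (leq_trans (size_polyMleq _ _)) // szg.
  rewrite size_polyDl size_polyXn ?size_polyN ?size_polyX; last by move: cq; clear; lia.
  by rewrite szs; clear; lia.
have szu m : (size (map_poly (horner_eval m) (line_prod s)) <= size s)%N.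
  apply/leq_sizeP => j; rewrite leq_eqVlt => /orP[/eqP<-|lt]; rewrite coef_map /=.
    by rewrite Ln raddf0.
  by have := size_line_prod_eval s m => /leq_sizeP/(_ _ lt); rewrite coef_map.
have f0 j : (q + c + 2 <= j < 2 * q)%N -> f`_j = 0.
  case/andP=> j1 j2; rewrite -coef_line_prod_top; last by rewrite szs; lia.
  suff -> : (line_prod s)`_j = 0 by rewrite coef0.
  have szj : (size ((line_prod s)`_j)%R <= q)%N.
    by apply: leq_trans (size_coef_line_prod _ _) _; rewrite szs; move: j1; clear; lia.
  apply/eqP; apply: contraTT szj => nzj; rewrite -ltnNge cardE.
  apply: max_poly_roots nzj _ (enum_uniq _); apply/allP => m _.
  rewrite rootE line_prod_coef_eval.
  have [A uE szA] := double_line_prod_eval (dbl m).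
  have Az i : (c < i)%N -> A`_i = 0.
    move=> ci; apply: nth_default; rewrite szA; have := szu m; rewrite szs.
    by move: (size _) ci; clear; lia.
  rewrite uE coef_mul_lacunary j2 !Az ?if_same ?mul0rn ?subr0 ?addr0 //; move: j1 j2 cq; clear; lia.
(* In [f = k *: (g * ('X^q - 'X))] the coefficient of index [q + i] is [k] times that of [g] at [i],
   since index [q + i - 1] exceeds the degree of [g]. *)
have g0 i : (c + 2 <= i < q)%N -> g`_i = 0.
  case/andP=> i1 i2; have := f0 (q + i)%N; rewrite fE coefZ mulrBr coefB coefMXn coefMX.
  rewrite (ltnNge (q + i) q) leq_addr addKn /=.
  have -> : (q + i == 0)%N = false by apply/negbTE; move: i1; clear; lia.
  rewrite [X in _ - X]nth_default; last first.
    by rewrite szg; move: (q) i1; clear=> n; lia.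
  rewrite subr0 => /(_ _)/eqP; rewrite mulf_eq0 (negPf k0) => H; apply/eqP/H.
  by move: (q) i1 i2; clear=> n; lia.
exists (drop_poly q g), (take_poly q g); split.
- by rewrite addrC mulrC poly_take_drop.
- by rewrite size_drop_poly szg -addnS addKn.
apply/leq_sizeP => i ci; rewrite coef_take_poly; case: ifP => // iq.
by apply: g0; rewrite iq andbT; move: ci; clear; lia.
Qed.
End Lacunary.

(** * Derivatives, [p]-th powers and split polynomials *)

Section Powers.
Variable F : finFieldType.
Local Notation q := #|F|.

Lemma card_pchar_pow p : p \in [pchar F] -> exists n, q = (p ^ n)%N.
Proof.
move=> pF; have /p_natP[n qE] : p.-nat q.
  have := pprimeChar_pgroup pF.
  by rewrite /pgroup.pgroup cardsT.
by exists n.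
Qed.

Lemma deriv_eq0_pow p (f : {poly F}) : p \in [pchar F] -> f^`() = 0 -> exists h, f = h ^+ p.
Proof.
move=> pF f'0; have p_gt0 : (0 < p)%N by apply: prime_gt0 (pcharf_prime pF).
have [n qE] := card_pchar_pow pF.
have n0 : (0 < n)%N by case: n qE => // qE; have := finNzRing_gt1 F; rewrite qE.
(* The inverse of the Frobenius map, because [a ^+ q = a]. *)
pose rt (a : F) := a ^+ (p ^ n.-1).
have rtK a : rt a ^+ p = a.
  by rewrite -exprM -expnSr prednK // -qE expf_card.
have pP : p \in [pchar {poly F}] by rewrite pchar_poly.
exists (\poly_(i < size f) rt f`_(i * p)).
rewrite poly_def -(pFrobenius_autE pP) rmorph_sum /=.
under eq_bigr do rewrite pFrobenius_autE exprZn rtK -exprM.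
apply/polyP => i; rewrite coef_sum.
have [/dvdnP[j ij]|ndvd] := boolP (p %| i)%N.
  have [js|js] := ltnP j (size f); last first.
    rewrite nth_default ?big1 // => [k _|]; last first.
      by rewrite ij (leq_trans js) // leq_pmulr.
    rewrite coefZ coefXn ij eqn_mul2r (gtn_eqF p_gt0) /=.
    by rewrite gtn_eqF ?mulr0 // (leq_trans _ js).
  rewrite (bigD1 (Ordinal js)) //= big1 => [|k kj].
    by rewrite coefZ coefXn ij eqxx mulr1 addr0.
  rewrite coefZ coefXn ij eqn_mul2r (gtn_eqF p_gt0) /=.
  by rewrite eq_sym -val_eqE in kj; rewrite (negPf kj) mulr0.
rewrite big1 => [|k _]; last first.
  rewrite coefZ coefXn; case: eqP => [ik|]; rewrite ?mulr0 //.
  by move: ndvd; rewrite ik dvdn_mull.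
case: i ndvd => [|i]; first by rewrite dvdn0.
rewrite (dvdn_pcharf pF) => ndvd.
have /eqP := coef_deriv f i; rewrite f'0 coef0 eq_sym -mulr_natr mulf_eq0 (negPf ndvd) orbF.
by move/eqP.
Qed.

Lemma prod_seq_XsubC (s : seq F) :
  \prod_(x <- s) ('X - x%:P) = \prod_b ('X - b%:P) ^+ count_mem b s.
Proof.
elim: s => [|x s IH]; first by rewrite big_nil big1.
rewrite big_cons IH (bigD1 x) //= [in RHS](bigD1 x) //= eqxx exprS mulrA; congr (_ * _).
by apply: eq_bigr => b; rewrite eq_sym => /negPf->.
Qed.

Lemma split_of_dvdp (f : {poly F}) (e : F -> nat) :
  f %| \prod_b ('X - b%:P) ^+ e b ->
  exists2 k, k != 0 & f = k *: \prod_b ('X - b%:P) ^+ mup b f.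
Proof.
have -> : \prod_b ('X - b%:P) ^+ e b =
    \prod_(x <- flatten [seq nseq (e b) b | b <- enum F]) ('X - x%:P).
  rewrite big_flatten big_map big_enum /=; apply: eq_bigr => b _.
  by rewrite big_nseq -Monoid.iteropE.
case/dvdp_prod_XsubC => m; set s := mask _ _; rewrite prod_seq_XsubC => fE.
have mE b : mup b f = count_mem b s.
  move/eqpP: fE => [[k1 k2] /andP[/= k10 k20] E].
  have C (k : F) (h : {poly F}) : k != 0 -> mup b (k *: h) = mup b h.
    by move=> k0; rewrite -mul_polyC; apply: mupMr; rewrite rootC.
  by rewrite -(C k1) // E C // mup_prod_XsubC_exp.
case/eqpP: fE => [[k1 k2] /andP[/= k10 k20] E].
exists (k2 / k1); first by rewrite mulf_neq0 ?invr_eq0.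
under eq_bigr do rewrite mE.
by rewrite mulrC -scalerA -E scalerA mulVf // scale1r.
Qed.

Lemma mup_deriv (f : {poly F}) b m :
  ('X - b%:P) ^+ m.+1 %| f -> ('X - b%:P) ^+ m %| f^`().
Proof.
case/dvdpP => h ->; rewrite derivM deriv_exp derivXsubC mul1r /=.
by rewrite dvdp_add // ?dvdp_mull // ?exprS ?dvdp_mull // -mulr_natr dvdp_mulr.
Qed.

(** By coprimality [a] divides its own derivative, which has smaller degree and so vanishes. *)
Lemma deriv_coprime_eq0 (a b : {poly F}) : a != 0 -> coprimep a b ->
  a * b^`() = a^`() * b -> a^`() = 0 /\ b^`() = 0.
Proof.
move=> a0 cop E.
have a'0 : a^`() = 0.
  apply/eqP; apply: contraTT isT => a'0.
  have /(dvdp_leq a'0) : a %| a^`() by rewrite -(Gauss_dvdpl _ cop) -E dvdp_mulr.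
  by rewrite leqNgt lt_size_deriv.
by split=> //; move/eqP: E; rewrite a'0 mul0r mulf_eq0 (negPf a0) => /eqP.
Qed.
End Powers.

(** With [A] and [B] the degrees of [a] and [b], this refutes the Wronskian bound at every level [E]
    that is a proper divisor of [r]. Multiplying by [E] gives [r ^ 2 <= (E + 1) * (E * A) + 1]. For
    [k >= 3] the bound [E * A < 2 * r] suffices; for [k = 2] it is sharpened to [A <= 3]. *)
Lemma level_arith r E k A B c : (10 < r)%N -> (c < 2 * r)%N -> (k * E = r)%N -> (1 < k)%N ->
  (E * A <= c)%N -> (E * B <= E * A + 1)%N -> (k * r <= E * A + B)%N -> False.
Proof.
move=> r10 cr kE k1 EA EB le.
have H1 : (r * r <= E * (E * A) + E * B)%N.
  by rewrite -mulnDr -{1}kE mulnAC [(k * r * E)%N]mulnC leq_mul2l le orbT.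
have H2 : (r * r <= (E + 1) * (E * A) + 1)%N by apply: leq_trans H1 _; nia.
have [k3|k2] := leqP 3 k.
  have E3 : (3 * E <= r)%N by rewrite -kE leq_mul2r k3 orbT.
  have : ((E + 1) * (E * A) <= (E + 1) * (2 * r))%N by rewrite leq_mul2l; apply/orP; right; lia.
  by move=> H3; nia.
have k2E : k = 2%N by lia.
subst k; have A3 : (A <= 3)%N.
  rewrite leqNgt; apply/negP => A4.
  have : (E * 4 <= E * A)%N by rewrite leq_mul2l A4 orbT.
  by lia.
have : ((E + 1) * (E * A) <= (E + 1) * (E * 3))%N by rewrite !leq_mul2l A3 !orbT.
by move=> H3; nia.
Qed.

(** * Fully reducible lacunary polynomials *)

Section SplitLacunary.
Variables (F : finFieldType) (e : F -> nat) (f1 f0 : {poly F}) (p c : nat).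
Local Notation q := #|F|.
Let g : {poly F} := \prod_b ('X - b%:P) ^+ e b.
Hypothesis pF : p \in [pchar F].
Hypothesis gE : g = 'X^q * f1 + f0.
Hypothesis sum_e : (\sum_b e b = q + c)%N.
Hypothesis szf1 : (size f1 <= c.+1)%N.
Hypothesis szf0 : (size f0 <= c.+2)%N.

Let q1 : (1 < q)%N. Proof. exact: finNzRing_gt1. Qed.
Let g_neq0 : g != 0. Proof. by rewrite monic_neq0 ?prod_XsubC_exp_monic. Qed.

Lemma size_lacunary_head : size f1 = c.+1.
Proof.
have szg : size g = (q + c).+1 by rewrite size_prod_XsubC_exp sum_e.
apply/eqP; rewrite eqn_leq szf1 ltnNge; apply: contraTN isT => /(nth_default 0) f1c.
have := congr1 (fun f : {poly F} => f`_(q + c)) gE.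
rewrite coefD coefXnM ltnNge leq_addr /= addKn f1c [f0`__]nth_default; last first.
  by apply: leq_trans szf0 _; move: (q) q1; lia.
have := prod_XsubC_exp_monic e; rewrite monicE lead_coefE -/g szg /= => /eqP->.
by move/eqP; rewrite addr0 oner_eq0.
Qed.

(* At level E, a power of the characteristic, the product g equals d * h ^+ E with
   h = 'X^Q * a + b and Q * E = q.  A root of h of multiplicity m is a root of
   multiplicity m - 1 of the Wronskian W and a root of T, so h divides T * W; the
   degrees then force W = 0 as long as E < sqrt q, whence a and b are p-th powers
   and the level can be raised. *)
Section Level.
Variables (E Q : nat) (d a b : {poly F}).
Hypothesis pE : [pchar F].-nat E.
Hypothesis QE : (Q * E = q)%N.
Hypothesis Q1 : (1 < Q)%N.
Hypothesis f1E : f1 = d * a ^+ E.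
Hypothesis f0E : f0 = d * b ^+ E.
Hypothesis cop : coprimep a b.
Let h : {poly F} := 'X^Q * a + b.
Let T : {poly F} := 'X * a ^+ E + b ^+ E.
Let W : {poly F} := a * b^`() - a^`() * b.

Let E0 : (0 < E)%N. Proof. by case: E QE => //; rewrite muln0 => H; move: q1; rewrite -H. Qed.
Let f1_neq0 : f1 != 0. Proof. by rewrite -size_poly_gt0 size_lacunary_head. Qed.
Let d0 : d != 0. Proof. by apply: contraNneq f1_neq0; rewrite f1E => ->; rewrite mul0r. Qed.
Let a0 : a != 0.
Proof. by apply: contraNneq f1_neq0; rewrite f1E => ->; rewrite expr0n (gtn_eqF E0) mulr0. Qed.

Lemma level_pow : h ^+ E = 'X^q * a ^+ E + b ^+ E.
Proof.
rewrite /h exprDn_pchar; last by rewrite (eq_pnat _ (@pchar_poly F)).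
by rewrite exprMn -exprM QE.
Qed.

Lemma level_dvd : g = d * h ^+ E.
Proof. by rewrite gE level_pow f1E f0E mulrDr mulrCA. Qed.

Let h_dvd : h %| g. Proof. by rewrite level_dvd dvdp_mull // -(prednK E0) exprS dvdp_mulr. Qed.
Let h0 : h != 0. Proof. by apply: contraNneq g_neq0 => h0; rewrite -dvd0p -h0. Qed.

Let size_pow (f : {poly F}) : f != 0 -> size (f ^+ E) = (E * (size f).-1).+1.
Proof.
by move=> fn0; rewrite mulnC -size_exp prednK // size_poly_gt0 expf_neq0.
Qed.

Lemma level_size_a : ((size d).-1 + E * (size a).-1 = c)%N.
Proof.
have := size_lacunary_head; rewrite f1E size_mul ?expf_neq0 // size_pow // addnS /=.
by move: d0; rewrite -size_poly_gt0; move: (size _) (_ * _)%N; clear=> *; lia.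
Qed.

Lemma level_size_b : (E * (size b).-1 <= E * (size a).-1 + 1)%N.
Proof.
have [->|b0] := eqVneq b 0; first by rewrite size_poly0 muln0.
have := szf0; have := level_size_a; rewrite f0E size_mul ?expf_neq0 // size_pow // addnS /=.
by move: d0; rewrite -size_poly_gt0; move: (size _) (E * _)%N (E * _)%N; clear=> *; lia.
Qed.

Let size_b_le : (size b <= (size a).+1)%N.
Proof.
have := level_size_b; move: a0; rewrite -size_poly_gt0 mulnC [(E * _)%N]mulnC.
by move: (size a) (size b) E E0; clear; move=> [|x] [|y] [|z] //=; nia.
Qed.

Lemma level_size : size h = (Q + size a)%N.
Proof.
rewrite /h size_polyDl size_monicM ?monicXn // size_polyXn //=.
apply: leq_ltn_trans size_b_le _.
by rewrite -[(size a).+1]/(1 + size a)%N ltn_add2r.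
Qed.

(** On [F] one has [x ^+ q = x], so [h ^+ E] and [T] take the same values. *)
Lemma level_root x : root h x -> x * a.[x] ^+ E + b.[x] ^+ E = 0.
Proof.
move=> /rootP hx; have := congr1 (fun f : {poly F} => f.[x]) level_pow.
by rewrite horner_exp hx expr0n (gtn_eqF E0) !(hornerE, horner_exp) expf_card => <-.
Qed.

(** As [p] divides [Q], the derivative of ['X^Q] vanishes, and [W] equals [a * h^]() -
    a^[() * h]. *)
Lemma level_mup x : (p %| Q)%N -> ('X - x%:P) ^+ (mup x h).-1 %| W.
Proof.
move=> pQ; case mE: (mup x h) => [|m]; first by rewrite expr0 dvd1p.
have hm : ('X - x%:P) ^+ m.+1 %| h by rewrite -mup_geq // mE.
have hE : h^`() = 'X^Q * a^`() + b^`().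
  rewrite derivD derivM derivXn -mulr_natr.
  have -> : Q%:R = 0 :> {poly F}.
    by apply/eqP; rewrite -(dvdn_pcharf (p := p)) ?pchar_poly.
  by rewrite mulr0 mul0r add0r.
have -> : W = a * h^`() - a^`() * h.
  by rewrite hE /W /h !mulrDr; ring.
rewrite dvdp_sub // dvdp_mull //; first exact: mup_deriv.
by apply: dvdp_trans hm; apply: dvdp_exp2l.
Qed.

Lemma level_dvd_wronskian : (p %| Q)%N -> h %| T * W.
Proof.
move=> pQ; have [k k0 ->] := split_of_dvdp h_dvd; rewrite dvdpZl //.
apply: prod_XsubC_exp_dvdp => x; case mE: (mup x h) => [|m]; first by rewrite expr0 dvd1p.
rewrite exprS dvdp_mul //; last by have := level_mup x pQ; rewrite mE.
rewrite dvdp_XsubCl /root /T !(hornerE, horner_exp) level_root //.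
by rewrite -dvdp_XsubCl XsubC_dvd // mE.
Qed.

(** Compare degrees in [h %| T * W]: that of [h] is [Q + deg a], that of [T] at most [E deg a + 1],
    that of [W] at most [deg a + deg b - 1]. *)
Lemma level_wronskian_bound : (p %| Q)%N -> T != 0 -> W != 0 ->
  (Q <= E * (size a).-1 + (size b).-1)%N.
Proof.
move=> pQ T0 W0; have := dvdp_leq (mulf_neq0 T0 W0) (level_dvd_wronskian pQ).
rewrite level_size size_mul //.
have szT : (size T <= (E * (size a).-1).+2)%N.
  apply: leq_trans (size_polyD _ _) _; rewrite geq_max; apply/andP; split.
    by rewrite mulrC size_mulX ?expf_neq0 // size_pow.
  have [->|b0] := eqVneq b 0; first by rewrite expr0n (gtn_eqF E0) size_poly0.
  by rewrite size_pow // ltnS; have := level_size_b; rewrite addn1.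
have szW : (size W <= (size a).-1 + (size b).-1)%N.
  have sda : (size a^`() <= (size a).-1)%N.
    by rewrite -ltnS prednK ?lt_size_deriv // size_poly_gt0.
  have sdb : (size b^`() <= (size b).-1)%N.
    have [->|b0] := eqVneq b 0; first by rewrite linear0 size_poly0.
    by rewrite -ltnS prednK ?lt_size_deriv // size_poly_gt0.
  apply: leq_trans (size_polyD _ _) _; rewrite size_polyN geq_max.
  move: a0; rewrite -size_poly_gt0 => sa; apply/andP; split;
    apply: leq_trans (size_polyMleq _ _) _.
    by move: (size a) (size b) (size (b^`())%R) sa sdb; clear=> *; lia.
  have [b0|] := eqVneq b 0.
    by move: (size a) (size (a^`())%R) sda; rewrite b0 size_poly0; clear=> *; lia.
  by rewrite -size_poly_gt0; move: (size a) (size b) (size (a^`())%R) sa sda; clear=> *; lia.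
move: a0; rewrite -size_poly_gt0.
move: szT szW; move: (size T) (size W) (size a) (size b) (E * _)%N; clear=> *; lia.
Qed.

Lemma level_a_neq0 : a != 0. Proof. exact: a0. Qed.
End Level.

Variable r : nat.
Hypothesis qE : q = (r ^ 2)%N.
Hypothesis r10 : (10 < r)%N.
Hypothesis cr : (c < 2 * r)%N.
Hypothesis e_lt : forall b, (e b < q)%N.
Hypothesis e_0 : exists b, e b = 0%N.

(** ['X * f1 + f0] agrees with [g] on [F], and some element of [F] is not a root of [g]. *)
Let tail_neq0 : 'X * f1 + f0 != 0.
Proof.
have [b eb] := e_0; apply: contra_eqN eb => /eqP f10.
rewrite -lt0n -(root_prod_XsubC_exp e) -/g gE rootE !(hornerE, horner_exp) expf_card.
by have := congr1 (fun f : {poly F} => f.[b]) f10; rewrite !hornerE => ->.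
Qed.

Let levels h j : r = (p ^ h)%N -> (j <= h)%N ->
  exists d a b : {poly F}, [/\ f1 = d * a ^+ (p ^ j), f0 = d * b ^+ (p ^ j) & coprimep a b].
Proof.
move=> rE; have p1 := prime_gt1 (pcharf_prime pF); have pp := pcharf_prime pF.
elim: j => [_|j IH jh].
  have nz : (f1 != 0) || (f0 != 0).
    apply: contraNT tail_neq0; rewrite negb_or !negbK => /andP[/eqP-> /eqP->].
    by rewrite mulr0 addr0.
  exists (gcdp f1 f0), (f1 %/ gcdp f1 f0), (f0 %/ gcdp f1 f0); split.
  - by rewrite expr1 mulrC divpK // dvdp_gcdl.
  - by rewrite expr1 mulrC divpK // dvdp_gcdr.
  exact: coprimep_div_gcd.
have [d [a [b [f1E f0E cop]]]] := IH (ltnW jh).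
pose E := (p ^ j)%N; pose k := (p ^ (h - j))%N.
have kE : (k * E = r)%N by rewrite -expnD subnK // ltnW.
have k1 : (1 < k)%N by rewrite -(expn0 p) ltn_exp2l // subn_gt0.
have Q1 : (1 < k * r)%N by apply: leq_trans k1 _; rewrite leq_pmulr //; lia.
have pE : [pchar F].-nat E by rewrite (eq_pnat _ (pcharf_eq pF)) pnatX pnat_id.
have QE : (k * r * E = q)%N by rewrite mulnAC kE qE.
have pQ : (p %| k * r)%N by rewrite dvdn_mulr // /k -(subnK (_ : 1 <= h - j)%N) ?subn_gt0 // addn1 expnS dvdn_mulr.
have T0 : 'X * a ^+ E + b ^+ E != 0.
  by apply: contraNneq tail_neq0 => T0; rewrite f1E f0E mulrCA -mulrDr T0 mulr0.
have a0 : a != 0 by exact: level_a_neq0 QE f1E.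
have W0 : a * b^`() - a^`() * b = 0.
  apply/eqP; apply: contraT => W0.
  have sa := level_size_a QE f1E.
  have sb := level_size_b QE f1E f0E.
  have := level_wronskian_bound pE QE Q1 f1E f0E pQ T0 W0.
  have sa' : (E * (size a).-1 <= c)%N by rewrite -sa leq_addl.
  by move/(level_arith r10 cr kE k1 sa' sb).
have [|a'0 b'0] := deriv_coprime_eq0 a0 cop; first by apply/eqP; rewrite -subr_eq0 W0.
have [[a1 aE] [b1 bE]] := (deriv_eq0_pow pF a'0, deriv_eq0_pow pF b'0).
exists d, a1, b1; split.
- by rewrite f1E aE -exprM -expnS.
- by rewrite f0E bE -exprM -expnS.
by move: cop; rewrite aE bE coprimep_pexpl ?coprimep_pexpr // prime_gt0.
Qed.

(** At level [E = r] the equation [deg d + r deg a = c < 2 r] leaves [deg a <= 1]. Degree one is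
    forced, and then [l] has degree [r + 1] and only simple roots. *)
Lemma split_lacunary_roots h : r = (p ^ h)%N ->
  #|[set b | (r <= e b)%N]| = r.+1 /\ forall b, (e b <= c)%N.
Proof.
move=> rE; have [d [a [b [f1E f0E cop]]]] := levels rE (leqnn h).
rewrite -rE in f1E f0E.
have r1 : (1 < r)%N by lia.
have QE : (r * r = q)%N by rewrite qE.
have pE : [pchar F].-nat r by rewrite (eq_pnat _ (pcharf_eq pF)) rE pnatX pnat_id ?(pcharf_prime pF).
have pr : (p %| r)%N by case: (h) rE r1 => [->//|h' -> _]; rewrite expnS dvdn_mulr.
have sa := level_size_a QE f1E.
have sb := level_size_b QE f1E f0E.
have a0 := level_a_neq0 QE f1E.
have gd := level_dvd pE QE f1E f0E.
have szh := level_size QE r1 f1E f0E.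
set l : {poly F} := 'X^r * a + b in gd szh.
have d0 : d != 0 by apply: contraNneq g_neq0; rewrite gd => ->; rewrite mul0r.
have l0 : l != 0 by rewrite -size_poly_gt0 szh ltn_addr // ltnW.
have A1 : ((size a).-1 <= 1)%N.
  rewrite leqNgt; apply/negP => A2.
  have : (r * 2 <= r * (size a).-1)%N by rewrite leq_mul2l A2 orbT.
  by move: sa cr; clear; move: (_ * _)%N; lia.
have B1 : ((size b).-1 <= (size a).-1)%N.
  rewrite leqNgt; apply/negP => BA.
  have : (r * ((size a).-1).+1 <= r * (size b).-1)%N by rewrite leq_mul2l BA orbT.
  by rewrite mulnS; move: sb r1; clear; move: (r * _)%N (r * _)%N; lia.
(* If [a] were constant, so would be [b], and [l ^+ r] would be a multiple of the [q]-th power of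
   one linear factor, against [e_lt]. *)
have sa2 : size a = 2%N.
  have sa_gt0 : (0 < size a)%N by rewrite size_poly_gt0.
  apply/eqP; apply: contraT => sa2; have {}sa1 : size a = 1%N.
    by move: (size a) A1 sa2 sa_gt0; clear; move=> [|[|[]]].
  have sb1 : (size b <= 1)%N by move: B1; rewrite sa1; case: (size b) => [|[]].
  have [a' a'E] : exists a', a = a'%:P by exists a`_0; apply: size1_polyC; rewrite sa1.
  have [b' b'E] : exists b', b = b'%:P by exists b`_0; exact: size1_polyC.
  have a'0 : a' ^+ r != 0 by rewrite expf_neq0 // -polyC_eq0 -a'E.
  have := level_pow a b pE QE; rewrite -/l a'E b'E -!polyC_exp => lr.
  pose z := - (b' ^+ r / a' ^+ r).
  have lz : l ^+ r = (a' ^+ r)%:P * ('X - z%:P) ^+ q.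
    rewrite lr exprDn_pchar; last first.
      by rewrite (eq_pnat _ (@pchar_poly F)) -QE pnatM pE.
    rewrite mulrDr mulrC -polyCN -polyC_exp expf_card opprK -polyCM.
    by rewrite mulrCA mulfV // mulr1.
  have : ('X - z%:P) ^+ q %| g by rewrite gd lz !dvdp_mull.
  by rewrite -mup_geq // mup_prod_XsubC_exp leqNgt e_lt.
(* For [a] and [b] of degree at most one the Wronskian is constant. It is nonzero because [a] has
   nonzero derivative, so [l] has no multiple root. *)
pose W := a * b^`() - a^`() * b.
have W0 : W != 0.
  apply/negP => /eqP/subr0_eq/(deriv_coprime_eq0 a0 cop)[a'0 _].
  have := coef_deriv a 0; rewrite a'0 coef0 mulr1n => /esym/eqP.
  have := lead_coef_eq0 a; rewrite lead_coefE sa2 /= => ->.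
  by rewrite (negPf a0).
have szW : (size W <= 1)%N.
  have sb2 : (size b <= 2)%N by move: B1; rewrite sa2; case: (size b) => [|[|[]]].
  apply/leq_sizeP => i i0.
  have aE : a = a`_1 *: 'X + (a`_0)%:P.
    apply/polyP => -[|[|j]]; rewrite coefD coefZ coefX coefC /= ?mulr0 ?mulr1 ?addr0 ?add0r //.
    by rewrite nth_default // sa2.
  have bE : b = b`_1 *: 'X + (b`_0)%:P.
    apply/polyP => -[|[|j]]; rewrite coefD coefZ coefX coefC /= ?mulr0 ?mulr1 ?addr0 ?add0r //.
    by rewrite nth_default // (leq_trans sb2).
  have -> : W = (a`_0 * b`_1 - a`_1 * b`_0)%:P.
    rewrite /W aE bE !derivD !derivZ !derivX !derivC !addr0 -!mul_polyC !coefD !coefCM !coefX !coefC /=.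
    rewrite !mulr0 !mulr1 !addr0 !add0r !polyCB !polyCM; ring.
  by rewrite coefC gtn_eqF.
have [w wE] : exists w, W = w%:P by exists W`_0; exact: size1_polyC.
have w0 : w != 0 by rewrite -polyC_eq0 -wE.
have mup1 x : (mup x l <= 1)%N.
  have := level_mup pE QE f1E f0E x pr; rewrite -/W -/l wE.
  case: (mup x l) => [|[|m]] //=; rewrite exprS => H.
  have : 'X - x%:P %| w%:P by apply: dvdp_trans H; rewrite dvdp_mulr.
  by rewrite dvdp_XsubCl rootC (negPf w0).
have sum_mup : (\sum_x mup x l = r.+1)%N.
  have [|k k0 lE] := @split_of_dvdp F l e.
    by rewrite -/g gd dvdp_mull // -(prednK (ltnW r1)) exprS dvdp_mulr.
  have := szh; rewrite {1}lE size_scale // size_prod_XsubC_exp sa2 addn2.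
  by case.
have eE x : e x = (mup x d + r * mup x l)%N.
  rewrite -(mup_prod_XsubC_exp e x) -/g gd mupM ?expf_neq0 //; congr (_ + _)%N.
  elim: (r) => [|k IH]; first by rewrite expr0 mul0n mupNroot // rootC oner_eq0.
  by rewrite exprS mupM ?expf_neq0 // IH mulSn.
(* Since [c - r < r], the factor [d] alone cannot give multiplicity [r]: the [x] with [r <= e x] are
   exactly the roots of [l]. *)
have mupd x : (mup x d <= c - r)%N.
  have : (size (('X - x%:P) ^+ mup x d) <= size d)%N by rewrite dvdp_leq // -mup_geq.
  rewrite size_exp_XsubC; move: sa; rewrite sa2 muln1; move: (size d) (mup x d); clear; lia.
have cr' : (r <= c)%N by rewrite -sa sa2 muln1 leq_addl.
split; last first.
  move=> x; rewrite eE; have := mupd x; have := mup1 x.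
  by move: (mup x l) (mup x d) cr'; clear; move=> [|[|]] //= m; rewrite ?muln0 ?muln1; lia.
rewrite -sum_mup -sum1dep_card big_mkcond /=; apply: eq_bigr => x _.
rewrite eE; have := mupd x; have := mup1 x.
by move: (mup x l) (mup x d) cr cr'; clear; move=> [|[|]] //= m; rewrite ?muln0 ?muln1 => *; case: leqP => //; lia.
Qed.
End SplitLacunary.

Lemma pencil_structure (F : finFieldType) (s : seq (F * F * F)) r c :
  #|F| = (r ^ 2)%N -> (10 < r)%N -> (c < 2 * r)%N ->
  all (fun t => (t.2, t.1.1) != (0, 0)) s ->
  (forall m b, 2 <= line_count s m b)%N ->
  (forall b, 0 < pencil_count s b <= #|F|)%N -> (exists b, pencil_count s b = 1%N) ->
  count (fun t => t.2 == 0) s = 1%N -> size s = (2 * #|F| + c).+1 ->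
  #|[set b | (r < pencil_count s b)%N]| = r.+1 /\ forall b, (pencil_count s b <= c.+1)%N.
Proof.
move=> qE r10 cr nz dbl pos [b1 pb1] one szs.
have pos1 b : (0 < pencil_count s b)%N by case/andP: (pos b).
have [p pp pF] := finPcharP F.
have [n qn] := card_pchar_pow pF.
have [h _ rE] : exists2 h, (h <= n)%N & r = (p ^ h)%N.
  by apply/dvdn_pfactor => //; rewrite -qn qE expnS dvdn_mulr.
have cq : (c + 2 < #|F|)%N by rewrite qE; nia.
have [sum_e [f1 [f0 [gE szf1 szf0]]]] := pencil_lacunary nz dbl pos1 one szs cq.
have e_lt b : ((pencil_count s b).-1 < #|F|)%N by rewrite prednK //; case/andP: (pos b).
have [|cardE le] := split_lacunary_roots pF gE sum_e szf1 szf0 qE r10 cr e_lt _ rE.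
  by exists b1; rewrite pb1.
split=> [|b]; last by rewrite -(prednK (pos1 b)) ltnS.
rewrite -[RHS]cardE; apply: eq_card => b; rewrite !inE; have := pos1 b; case: (pencil_count s b) => [|n'] //.
Qed.

(** * Incidence and coordinates in the plane *)

Section Plane.
Variable F : finFieldType.
Local Notation q := #|F|.
Implicit Types (P Q : point F) (l m : line F).

Let dimV : \dim {: 'rV[F]_3} = 3%N. Proof. by rewrite dimvf /dim /= mul1n. Qed.

Lemma dim_point P : \dim (val P) = 1%N. Proof. exact/eqP/(valP P). Qed.
Lemma dim_line l : \dim (val l) = 2%N. Proof. exact/eqP/(valP l). Qed.

Definition vec P : 'rV[F]_3 := vpick (val P).

Lemma vec_neq0 P : vec P != 0.
Proof. by rewrite vpick0 -dimv_eq0 dim_point. Qed.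

Lemma point_vec P : val P = <[vec P]>%VS.
Proof. by apply/esym/eqP; rewrite eqEdim -memvE memv_pick dim_vline vec_neq0 dim_point. Qed.

Lemma incidentE P l : incident P l = (vec P \in val l).
Proof. by rewrite /incident point_vec -memvE. Qed.

Lemma point_of_vec (v : 'rV[F]_3) : v != 0 -> exists P, val P = <[v]>%VS.
Proof. by move=> v0; have d1 : \dim <[v]> == 1%N; [rewrite dim_vline v0 | exists (exist _ <[v]>%VS d1)]. Qed.

Lemma join_dim P Q : P != Q -> \dim (val P + val Q) = 2%N.
Proof.
move=> PQ; have PQ0 : (val P :&: val Q)%VS = 0%VS.
  apply/eqP; rewrite -dimv_eq0; apply: contraNT PQ => d0; apply/eqP/val_inj/eqP.
  have dI : (0 < \dim (val P :&: val Q))%N by rewrite lt0n.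
  have EP : (val P :&: val Q)%VS = val P by apply/eqP; rewrite eqEdim capvSl dim_point.
  have EQ : (val P :&: val Q)%VS = val Q by apply/eqP; rewrite eqEdim capvSr dim_point.
  by rewrite -EP -[in X in _ == X]EQ.
by have := dimv_sum_cap (val P) (val Q); rewrite PQ0 dimv0 addn0 !dim_point.
Qed.

Lemma join_line P Q : P != Q -> exists2 l, incident P l & incident Q l.
Proof.
move=> PQ; exists (exist _ (val P + val Q)%VS (introT eqP (join_dim PQ))).
  exact: addvSl.
exact: addvSr.
Qed.

Lemma line_uniq P Q l m : P != Q -> incident P l -> incident Q l ->
  incident P m -> incident Q m -> l = m.
Proof.
move=> PQ Pl Ql Pm Qm; apply/val_inj.
have E k : incident P k -> incident Q k -> (val P + val Q)%VS = val k.
  by move=> Pk Qk; apply/eqP; rewrite eqEdim dim_line join_dim // leqnn subv_add andbT; apply/andP.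
by rewrite -(E l) // -(E m).
Qed.

Lemma meet_point l m : exists P, incident P l && incident P m.
Proof.
have d0 : (val l :&: val m)%VS != 0%VS.
  rewrite -dimv_eq0 -lt0n; have := dimv_sum_cap (val l) (val m).
  have : (\dim (val l + val m) <= 3)%N by apply: leq_trans (dimvS (subvf _)) _; rewrite dimV.
  by rewrite !dim_line; move: (\dim _) (\dim _); lia.
have v0 : vpick (val l :&: val m)%VS != 0 by rewrite vpick0.
have [P PE] := point_of_vec v0; exists P.
by rewrite /incident PE -!memvE -memv_cap memv_pick.
Qed.

Lemma point_uniq l m P Q : l != m -> incident P l -> incident P m ->
  incident Q l -> incident Q m -> P = Q.
Proof.
move=> lm Pl Pm Ql Qm; apply/eqP; apply: contraNT lm => PQ; apply/eqP.
exact: line_uniq PQ Pl Ql Pm Qm.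
Qed.

(** Each nonzero vector of [U] spans exactly one point, and each point contains [q - 1] nonzero
    vectors. *)
Lemma card_points_vspace (U : {vspace 'rV[F]_3}) :
  (#|[set P : point F | (val P <= U)%VS]| * q.-1 = (q ^ \dim U).-1)%N.
Proof.
have cU (W : {vspace 'rV[F]_3}) : #|[pred v in W | v != 0]| = (q ^ \dim W).-1.
  by rewrite -card_vspace [in RHS](cardD1 0) mem0v /=; apply: eq_card => v; rewrite !inE andbC.
rewrite -cU -sum_nat_const -[RHS]sum1_card.
have -> : q.-1 = (q ^ 1).-1 by rewrite expn1.
under eq_bigr => P _ do rewrite -(dim_point P) -cU -sum1_card.
rewrite (exchange_big_dep (fun v : 'rV[F]_3 => (v \in U) && (v != 0))) => [|P v]; last first.
  by rewrite !inE => PU /andP[vP ->]; rewrite andbT; apply: subvP PU _ vP.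
apply: eq_big => [v|v]; rewrite ?inE // => /andP[vU v0].
have [P PE] := point_of_vec v0.
rewrite (big_pred1 P) // => Q; rewrite !inE v0 andbT.
apply/andP/eqP => [[_ vQ]|->].
  by apply/val_inj/eqP; rewrite PE eq_sym eqEdim -memvE vQ dim_vline v0 dim_point.
by rewrite PE -memvE vU memv_line.
Qed.

Let q1 : (1 < q)%N. Proof. exact: finNzRing_gt1. Qed.

Lemma card_points_line l : #|[set P | incident P l]| = q.+1.
Proof.
have := card_points_vspace (val l); rewrite dim_line.
have -> : [set P : point F | (val P <= val l)%VS] = [set P | incident P l] by [].
have -> : ((q ^ 2).-1 = q.+1 * q.-1)%N by move: (q) q1; clear; lia.
by move/eqP; rewrite eqn_pmul2r => [/eqP//|]; rewrite -subn1 subn_gt0.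
Qed.

Lemma card_points : #|{: point F}| = (q ^ 2 + q + 1)%N.
Proof.
have := card_points_vspace fullv; rewrite dimV.
have -> : [set P : point F | (val P <= fullv)%VS] = setT by apply/setP => P; rewrite !inE subvf.
have -> : ((q ^ 3).-1 = (q ^ 2 + q + 1) * q.-1)%N by move: (q) q1; clear; nia.
by rewrite cardsT => /eqP; rewrite eqn_pmul2r => [/eqP//|]; rewrite -subn1 subn_gt0.
Qed.

(* Every point other than P is on exactly one line through P. *)
Lemma sum_pencil P (w : point F -> nat) :
  (\sum_(l | incident P l) \sum_(Q | (Q != P) && incident Q l) w Q = \sum_(Q | Q != P) w Q)%N.
Proof.
rewrite (exchange_big_dep (fun Q => Q != P)) => [|l Q _ /andP[]//]; apply: eq_bigr => Q QP.
have [l Ql Pl] := join_line QP; rewrite (big_pred1 l) // => m /=.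
rewrite QP /=; apply/andP/eqP => [[Pm Qm]|->//].
exact: line_uniq QP Qm Pm Ql Pl.
Qed.

Lemma card_pencil P : #|[set l | incident P l]| = q.+1.
Proof.
have := sum_pencil P (fun=> 1%N).
rewrite sum1_card (cardC1 P) card_points.
have -> : (\sum_(l | incident P l) \sum_(Q | (Q != P) && incident Q l) 1 =
    #|[set l | incident P l]| * q)%N.
  rewrite -sum_nat_const; apply: eq_big => [l|l Pl]; first by rewrite inE.
  have := card_points_line l; rewrite (cardsD1 P) inE Pl => -[<-].
  by rewrite sum1dep_card; apply: eq_card => Q; rewrite !inE.
have -> : ((q ^ 2 + q + 1).-1 = q.+1 * q)%N by move: (q) q1; clear; nia.
by move/eqP; rewrite eqn_pmul2r => [/eqP//|]; apply: ltnW.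
Qed.

Lemma card_lines : #|{: line F}| = (q ^ 2 + q + 1)%N.
Proof.
have : (\sum_(P : point F) \sum_(l | incident P l) 1 = \sum_(l : line F) \sum_(P | incident P l) 1)%N.
  by rewrite (exchange_big_dep xpredT).
under eq_bigr do rewrite sum1dep_card card_pencil.
under [in RHS]eq_bigr do rewrite sum1dep_card card_points_line.
by rewrite !sum_nat_const => /eqP; rewrite eqn_pmul2r // => /eqP <-; rewrite -card_points cardT.
Qed.

End Plane.

(** * Lines as kernels of linear forms, and coordinates *)

Section Covectors.
Variable F : finFieldType.
Local Notation q := #|F|.
Implicit Types (P Q : point F) (l m : line F).

(** The value depends on the representative [vec P]; only its vanishing is a property of the
    point. *)
Definition ev (c : 'cV[F]_3) (P : point F) : F := (vec P *m c) 0 0.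

Lemma ker_mulmxr_dim (c : 'cV[F]_3) : c != 0 -> \dim (lker (linfun (mulmxr c : 'rV[F]_3 -> 'rV[F]_1))) = 2%N.
Proof.
move=> c0; set f := linfun _.
have := limg_ker_dim f fullv; rewrite capfv dimvf /dim /= mul1n.
suff -> : \dim (f @: fullv) = 1%N by rewrite addn1 => -[].
apply/eqP; rewrite eqn_leq; apply/andP; split.
  by apply: leq_trans (dimvS (subvf _)) _; rewrite dimvf.
rewrite lt0n dimv_eq0; apply: contraNneq c0 => f0; apply/eqP/colP => i.
have : f (delta_mx 0 i) \in (f @: fullv)%VS by rewrite memv_img ?memvf.
rewrite f0 memv0 lfunE /= => /eqP/matrixP/(_ 0 0).
by rewrite -rowE !mxE.
Qed.

Lemma line_of_covec (c : 'cV[F]_3) : c != 0 ->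
  exists l, forall P, incident P l = (ev c P == 0).
Proof.
move=> c0; exists (exist _ (lker (linfun (mulmxr c : 'rV[F]_3 -> 'rV[F]_1))) (introT eqP (ker_mulmxr_dim c0))) => P.
rewrite incidentE /= memv_ker lfunE /= /ev.
apply/eqP/eqP => [->|E]; first by rewrite mxE.
by apply/matrixP => i j; rewrite !ord1 E mxE.
Qed.

Lemma covec_of_line l : exists c : 'cV[F]_3, forall P, incident P l = (ev c P == 0).
Proof.
pose A : 'M[F]_(2, 3) := \matrix_(i < 2) (vbasis (val l))`_i.
have : cokermx A != 0.
  rewrite -mxrank_eq0 mxrank_coker subn_eq0 -ltnNge.
  by apply: leq_ltn_trans (rank_leq_row A) _.
case/matrix0Pn => i [j nz].
pose c := col j (cokermx A).
have c0 : c != 0 by apply: contraNneq nz => /matrixP/(_ i 0); rewrite !mxE => ->.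
have Ac : A *m c = 0 by rewrite /c colE mulmxA mulmx_coker mul0mx.
have sub : (val l <= lker (linfun (mulmxr c : 'rV[F]_3 -> 'rV[F]_1)))%VS.
  rewrite -(span_basis (vbasisP (val l))); apply/span_subvP => v vb.
  have iv : (index v (vbasis (val l)) < 2)%N.
    by have := vb; rewrite -index_mem => /leq_trans; apply; rewrite size_tuple dim_line.
  rewrite memv_ker lfunE /=.
  have <- : row (Ordinal iv) A = v by rewrite rowK nth_index.
  by rewrite -row_mul Ac row0.
exists c => P; rewrite incidentE.
have -> : val l = lker (linfun (mulmxr c : 'rV[F]_3 -> 'rV[F]_1)).
  by apply/eqP; rewrite eqEdim sub ker_mulmxr_dim // dim_line.
rewrite memv_ker lfunE /= /ev.
apply/eqP/eqP => [->|E]; first by rewrite mxE.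
by apply/matrixP => a b; rewrite !ord1 E mxE.
Qed.

(* A triangle of lines serves as coordinate axes x = 0, y = 0, z = 0. *)
Section Chart.
Variables lx ly lz : line F.
Hypothesis triangle : forall P, ~~ [&& incident P lx, incident P ly & incident P lz].

(** The family [al] consists of the lines missing the vertex [(0 : 1 : 0)] of [lx] and [lz], and
    [vl] of the lines through it other than [lz]. *)
Lemma chart : exists co : point F -> F * F * F,
  [/\ forall P, incident P lx = ((co P).1.1 == 0),
      forall P, incident P ly = ((co P).1.2 == 0),
      forall P, incident P lz = ((co P).2 == 0),
      exists2 al : F * F -> line F, injective al &
        forall b P, incident P (al b) = ((co P).2 * b.2 + ((co P).1.1 * b.1 - (co P).1.2) == 0)
    & exists2 vl : F -> line F, injective vl &
        forall b P, incident P (vl b) = ((co P).2 * b + (co P).1.1 == 0)].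
Proof.
have [cx cxE] := covec_of_line lx; have [cy cyE] := covec_of_line ly.
have [cz czE] := covec_of_line lz.
have ne P : ~~ [&& ev cx P == 0, ev cy P == 0 & ev cz P == 0].
  by rewrite -cxE -cyE -czE.
have evL (k : F) (c c' : 'cV[F]_3) P : ev (k *: c + c') P = ev c P * k + ev c' P.
  by rewrite /ev mulmxDr -scalemxAr !mxE mulrC.
have evN (c : 'cV[F]_3) P : ev (- c) P = - ev c P by rewrite /ev mulmxN mxE.
have ev0 P : ev 0 P = 0 by rewrite /ev mulmx0 mxE.
have [Rxz /andP[]] := meet_point lx lz; rewrite cxE czE => /eqP Rx /eqP Rz.
have [Ryz /andP[]] := meet_point ly lz; rewrite cyE czE => /eqP R'y /eqP R'z.
have Ry : ev cy Rxz != 0 by have := ne Rxz; rewrite Rx Rz eqxx /= andbT.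
have R'x : ev cx Ryz != 0 by have := ne Ryz; rewrite R'y R'z eqxx /= !andbT.
pose ca (b : F * F) := b.2 *: cz + (b.1 *: cx + - cy).
have caE b P : ev (ca b) P = ev cz P * b.2 + (ev cx P * b.1 - ev cy P) by rewrite !evL evN.
have ca0 b : ca b != 0.
  apply: contraNneq Ry => c0; have := caE b Rxz; rewrite c0 ev0 Rx Rz !mul0r !add0r.
  by move/esym/eqP; rewrite oppr_eq0.
pose cv (b : F) := b *: cz + cx.
have cv0 b : cv b != 0.
  apply: contraNneq R'x => c0; have := evL b cz cx Ryz.
  by rewrite -/(cv b) c0 ev0 R'z mul0r add0r => <-.
have [al alE] := fin_all_exists (fun b => line_of_covec (ca0 b)).
have [vl vlE] := fin_all_exists (fun b => line_of_covec (cv0 b)).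
exists (fun P => (ev cx P, ev cy P, ev cz P)); split=> //=.
- exists al => [[m b] [m' b'] E|b P]; last by rewrite alE caE.
  have P_eq P : incident P (al (m, b)) ->
      ev cz P * b + ev cx P * m = ev cy P /\ ev cz P * b' + ev cx P * m' = ev cy P.
    move=> Pl; have := Pl; have := Pl; rewrite {1}E !alE !caE /=.
    by rewrite !addrA !subr_eq0 => /eqP-> /eqP->.
  (* The intersection with [z = 0] determines the slope, the one with [x = 0] the intercept. *)
  have [S /andP[/P_eq[E1 E2]]] := meet_point (al (m, b)) lz; rewrite czE => /eqP Sz.
  have [T /andP[/P_eq[E3 E4]]] := meet_point (al (m, b)) lx; rewrite cxE => /eqP Tx.
  move: E1 E2 E3 E4; rewrite Sz Tx !mul0r !add0r !addr0 => E1 E2 E3 E4.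
  have Sx : ev cx S != 0.
    by apply: contraNneq (ne S) => Sx; rewrite Sz Sx -E1 Sx mul0r eqxx.
  have Tz : ev cz T != 0.
    by apply: contraNneq (ne T) => Tz; rewrite Tx Tz -E3 Tz mul0r eqxx.
  by rewrite (mulfI Sx (etrans E1 (esym E2))) (mulfI Tz (etrans E3 (esym E4))).
exists vl => [b b' E|b P]; last by rewrite vlE /cv evL.
have [S /andP[Sl]] := meet_point (vl b) ly; rewrite cyE => /eqP Sy.
have := Sl; have := Sl; rewrite {1}E !vlE /cv !evL !addr_eq0 => /eqP E1 /eqP E2.
have Sz : ev cz S != 0.
  apply: contraNneq (ne S) => Sz; rewrite Sy Sz eqxx andbT /= andbT.
  by rewrite -oppr_eq0 -E1 Sz mul0r.
by apply: (mulfI Sz); rewrite E1 E2.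
Qed.
End Chart.
End Covectors.

(** * Indices, secants and double blocking sets *)

Section Bounds.
Variable F : finFieldType.
Local Notation q := #|F|.
Implicit Types (P Q : point F) (l m : line F) (A B S : {set point F}).

Definition npt A l : nat := #|[set P in A | incident P l]|.
Definition deficiency A l : nat := 2 - npt A l.

Let q1 : (1 < q)%N. Proof. exact: finNzRing_gt1. Qed.

Lemma line_avoiding P : exists l, ~~ incident P l.
Proof.
apply/existsP; rewrite -negb_forall; apply/negP => /forallP all.
have := card_pencil P; have -> : [set l | incident P l] = setT.
  by apply/setP => l; rewrite !inE all.
by rewrite cardsT card_lines; move: (q) q1; clear; nia.
Qed.

Lemma another_line P l : exists2 m, incident P m & m != l.
Proof.
have : (0 < #|[set m | incident P m] :\ l|)%N.
  have := cardsD1 l [set m | incident P m]; rewrite card_pencil.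
  by case: (l \in _) => /= E; move: (q) q1 E; clear; lia.
by case/card_gt0P => m; rewrite !inE => /andP[]; exists m.
Qed.

Lemma pencil_param P l (f : F -> line F) : incident P l -> injective f ->
  (forall b, incident P (f b)) -> (forall b, f b != l) ->
  [set m | incident P m] :\ l = [set f b | b in F].
Proof.
move=> Pl fI Pf fl; apply/esym/eqP; rewrite eqEcard; apply/andP; split.
  by apply/subsetP => m /imsetP[b _ ->]; rewrite !inE fl Pf.
have := cardsD1 l [set m | incident P m]; rewrite card_pencil inE Pl add1n => -[<-].
by rewrite card_imset.
Qed.

Lemma sum_pencil_param P l (f : F -> line F) (w : line F -> nat) :
  incident P l -> injective f -> (forall b, incident P (f b)) -> (forall b, f b != l) ->
  (\sum_(m | incident P m) w m = w l + \sum_b w (f b))%N.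
Proof.
move=> Pl fI Pf fl; rewrite (bigD1 l) //=; congr (_ + _)%N.
have -> : (\sum_(i | incident P i && (i != l)) w i = \sum_(i in [set m | incident P m] :\ l) w i)%N.
  by apply: eq_bigl => m; rewrite !inE andbC.
by rewrite (pencil_param Pl fI Pf fl) big_imset //= => x y _ _; apply: fI.
Qed.

Lemma count_co (co : point F -> F * F * F) A (p : pred (F * F * F)) l :
  (forall P, incident P l = p (co P)) -> count p [seq co P | P <- enum A] = npt A l.
Proof.
move=> lE; rewrite count_map -size_filter /npt cardE /enum_mem -filter_predI.
by congr size; apply: eq_filter => P /=; rewrite inE lE andbC.
Qed.

Lemma npt_remove A P l : P \in A -> npt (A :\ P) l = (npt A l - incident P l)%N.
Proof.
move=> PA; rewrite /npt [in RHS](cardsD1 P) inE PA addKn; apply: eq_card => Q.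
by rewrite !inE andbA.
Qed.

(** Coordinates are chosen with [P = (1 : 0 : 0)] and the secant [l] as [z = 0]. As [l] has
    deficiency zero, the index of [P] is carried by the [q] lines [al (0, b)]. *)
Lemma index_lemma S P l : P \notin S -> incident P l -> (2 <= npt S l)%N ->
  let i := (\sum_(m | incident P m) deficiency S m)%N in
  is_true (3 * q * i <= \sum_m deficiency S m + i * (i + #|S|))%N.
Proof.
move=> PS Pl dl i.
have [ly Ply lyl] := another_line P l; have [lx Plx] := line_avoiding P.
have onP R : incident R ly -> incident R l -> R = P.
  by move=> R1 R2; apply: point_uniq lyl R1 R2 Ply Pl.
have [R|co [xE yE zE [al alI alE] _]] := @chart F lx ly l.
  by apply/negP => /and3P[Rx /onP RP /RP E]; rewrite -E Rx in Plx.
pose s := [seq co R | R <- enum S].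
have cnt (m b : F) : line_index s m b = deficiency S (al (m, b)).
  by rewrite /line_index /line_count (@count_co co S _ (al (m, b))) // => R; rewrite alE.
have [Py Pz] : (co P).1.2 = 0 /\ (co P).2 = 0 by split; apply/eqP; rewrite -?yE -?zE.
have Pal b : incident P (al (0, b)) by rewrite alE Py Pz mul0r mulr0 subr0 addr0.
have nl b : al (0, b) != l.
  have [R /andP[Rx Rz]] := meet_point lx l.
  have Ry : (co R).1.2 != 0.
    by rewrite -yE; apply: contraNN Plx => Ry; rewrite -(onP R).
  apply/eqP => E; have := Rz; rewrite -{1}E alE; move: Rz; rewrite zE => /eqP->.
  by rewrite mul0r mulr0 add0r sub0r oppr_eq0 (negPf Ry).
have iE : i = (\sum_b line_index s 0%R b)%N.
  rewrite /i (sum_pencil_param (l := l) (f := fun b => al (0, b))) //; last first.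
    by move=> b b' /alI[].
  rewrite /deficiency; move: dl; rewrite -subn_eq0 => /eqP->.
  by rewrite add0n; apply: eq_bigr => b _; rewrite cnt.
have szs : size s = #|S| by rewrite size_map -cardE.
have le : (\sum_(m : F) \sum_b line_index s m b <= \sum_l deficiency S l)%N.
  have -> : (\sum_(m : F) \sum_b line_index s m b = \sum_(m : F) \sum_b deficiency S (al (m, b)))%N.
    by apply: eq_bigr => m _; apply: eq_bigr => b _; apply: cnt.
  rewrite pair_big /= (eq_bigr (fun b => deficiency S (al b))) => [|[m b]] //.
  have <- : (\sum_(m in [set al b | b in {: F * F}]) deficiency S m = \sum_b deficiency S (al b))%N.
    by rewrite big_imset //= => x y _ _; apply: alI.
  by rewrite big_mkcond leq_sum // => m _; case: ifP.
apply: leq_trans (leq_add le (leqnn _)); rewrite iE -szs; apply: index_bound.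
apply/allP => _ /mapP[R RS ->]; rewrite xpair_eqE -zE -yE.
by apply: contraNN PS => /andP[Rz Ry]; rewrite -(onP R) // -mem_enum.
Qed.
End Bounds.

(** * Secants through a point of a double blocking set *)

Section Secants.
Variable F : finFieldType.
Local Notation q := #|F|.
Implicit Types (P Q : point F) (l m : line F) (A B S : {set point F}).

Let q1 : (1 < q)%N. Proof. exact: finNzRing_gt1. Qed.

Lemma npt_le B l : (npt B l <= q.+1)%N.
Proof.
rewrite -(card_points_line l); apply: subset_leq_card; apply/subsetP => P.
by rewrite !inE => /andP[].
Qed.

(** Put [P] at [(1 : 0 : 0)] and [l] at [y = 0]. Deleting [P] makes [l] a tangent, while all other
    lines of the form [al (m, b)] keep two points, so [single_tangent_size] applies to [B :\ P]. *)
Lemma unique_two_secant_card B P l : P \in B -> incident P l -> npt B l = 2%N ->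
  (forall m, 2 <= npt B m)%N -> (forall m, incident P m -> m != l -> 3 <= npt B m)%N ->
  (3 * q <= #|B| + 1)%N.
Proof.
move=> PB Pl l2 dbl tri.
have [lz Plz lzl] := another_line P l; have [lx Plx] := line_avoiding P.
have onP R : incident R l -> incident R lz -> R = P.
  by move=> R1 R2; apply: point_uniq lzl R2 R1 Plz Pl.
have [R|co [xE yE zE [al alI alE] _]] := @chart F lx l lz.
  by apply/negP => /and3P[Rx /onP RP /RP E]; rewrite -E Rx in Plx.
pose s := [seq co R | R <- enum (B :\ P)].
have szs : (size s).+1 = #|B| by rewrite size_map -cardE (cardsD1 P B) PB.
have [Py Pz] : (co P).1.2 = 0 /\ (co P).2 = 0 by split; apply/eqP; rewrite -?yE -?zE.
have cnt (m b : F) : line_count s m b = (npt B (al (m, b)) - incident P (al (m, b)))%N.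
  rewrite -npt_remove // /line_count (@count_co F co _ _ (al (m, b))) // => R; exact: alE.
have one : line_count s 0 0 = 1%N.
  rewrite /line_count (@count_co F co _ _ l) ?npt_remove // ?l2 ?Pl // => R.
  by rewrite !mulr0 add0r sub0r oppr_eq0 yE.
have nz : all (fun t => (t.2, t.1.2) != (0, 0)) s.
  apply/allP => _ /mapP[R RB ->]; rewrite xpair_eqE -zE -yE; move: RB; rewrite mem_enum !inE.
  by case/andP=> RP _; apply: contraNN RP => /andP[Rz Ry]; rewrite (onP R).
have ge2 (m b : F) : (m, b) != (0, 0) -> (2 <= line_count s m b)%N.
  rewrite xpair_eqE negb_and => mb; rewrite cnt.
  have PalE : incident P (al (m, b)) = (m == 0).
    rewrite alE Py Pz mul0r add0r subr0 mulf_eq0 -xE (negPf Plx) //.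
  rewrite PalE; have [m0|m0] := eqVneq m 0; last by rewrite subn0.
  move: mb; rewrite m0 eqxx /= => b0.
  suff t3 : (3 <= npt B (al (0%R, b)))%N by move: t3; case: (npt _ _) => [|[|[|]]].
  apply: tri; first by rewrite alE Py Pz mulr0 mul0r subr0 addr0.
  have [R /andP[Rx Ry]] := meet_point lx l.
  have Rz : (co R).2 != 0.
    by rewrite -zE; apply: contraNN Plx => Rz; rewrite -(onP R).
  apply/eqP => E; have := Ry; rewrite -{1}E alE; move: Ry; rewrite yE => /eqP->.
  by rewrite mulr0 subrr addr0 mulf_eq0 (negPf b0) (negPf Rz).
have := single_tangent_size q1 nz ge2 one; rewrite -szs; lia.
Qed.

(** Put [P] at [(0 : 1 : 0)], with [l] as [z = 0] and [l'] as [x = 0]. After deleting [P], [l]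
    supplies the single point at infinity and [l'] a line with [pencil_count] one, that is, an
    exponent zero in the lacunary product. *)
Lemma long_secants_card B P l l' r c :
  q = (r ^ 2)%N -> (10 < r)%N -> (c < 2 * r)%N -> #|B| = (2 * q + 2 + c)%N ->
  (forall m, 2 <= npt B m)%N -> P \in B -> incident P l -> npt B l = 2%N ->
  incident P l' -> npt B l' = 2%N -> l' != l ->
  #|[set m | incident P m & (r + 2 <= npt B m)%N]| = r.+1 /\
  forall m, incident P m -> (npt B m <= c + 2)%N.
Proof.
move=> qE r10 cr cB dbl PB Pl l2 Pl' l'2 ll.
have [ly Ply] := line_avoiding P.
have onP R : incident R l' -> incident R l -> R = P.
  by move=> R1 R2; apply: point_uniq ll R1 R2 Pl' Pl.
have [R|co [xE yE zE [al alI alE] [vl vlI vlE]]] := @chart F l' ly l.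
  by apply/negP => /and3P[/onP RP Ry /RP E]; rewrite -E Ry in Ply.
pose s := [seq co R | R <- enum (B :\ P)].
have szs : size s = (2 * q + c).+1.
  apply: succn_inj; have -> : (size s).+1 = #|B| by rewrite size_map -cardE (cardsD1 P B) PB.
  by rewrite cB addnAC addn2.
have [Px Pz] : (co P).1.1 = 0 /\ (co P).2 = 0 by split; apply/eqP; rewrite -?xE -?zE.
have nz : all (fun t => (t.2, t.1.1) != (0, 0)) s.
  apply/allP => _ /mapP[R RB ->]; rewrite xpair_eqE -zE -xE; move: RB; rewrite mem_enum !inE.
  by case/andP=> RP _; apply: contraNN RP => /andP[Rz Rx]; rewrite (onP R).
have ge2 (m b : F) : (2 <= line_count s m b)%N.
  rewrite /line_count (@count_co F co _ _ (al (m, b))) => [|R]; last exact: alE.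
  rewrite npt_remove // alE Px Pz !mul0r add0r sub0r oppr_eq0 -yE (negPf Ply) subn0; exact: dbl.
have Pvl b : incident P (vl b) by rewrite vlE Px Pz mul0r addr0.
have pcE b : (pencil_count s b).+1 = npt B (vl b).
  rewrite /pencil_count (@count_co F co _ _ (vl b)) => [|R]; last exact: vlE.
  by rewrite npt_remove // Pvl subn1 prednK // (leq_trans _ (dbl _)).
have nl b : vl b != l.
  have [R /andP[Ry Rz]] := meet_point ly l.
  have Rx : (co R).1.1 != 0.
    by rewrite -xE; apply: contraNN Ply => Rx; rewrite -(onP R).
  apply/eqP => E; have := Rz; rewrite -{1}E vlE; move: Rz; rewrite zE => /eqP->.
  by rewrite mul0r add0r (negPf Rx).
have pencilE := pencil_param Pl vlI Pvl nl.
have one : count (fun t => t.2 == 0) s = 1%N.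
  by rewrite (@count_co F co _ _ l) // npt_remove // l2 Pl.
have pos b : (0 < pencil_count s b <= q)%N.
  by have := dbl (vl b); have := npt_le B (vl b); rewrite -pcE !ltnS => -> ->.
have ex1 : exists b, pencil_count s b = 1%N.
  have : l' \in [set vl b | b in F] by rewrite -pencilE !inE ll Pl'.
  by case/imsetP => b _ E; exists b; apply: succn_inj; rewrite pcE -E.
have [cardE le] := pencil_structure qE r10 cr nz ge2 pos ex1 one szs.
have inPencil m : incident P m -> m = l \/ exists b, m = vl b.
  move=> Pm; have [->|ml] := eqVneq m l; [by left | right].
  have : m \in [set vl b | b in F] by rewrite -pencilE !inE ml Pm.
  by case/imsetP => b _ ->; exists b.
split; last first.
  move=> m /inPencil[->|[b ->]]; first by rewrite l2 leq_addl.
  by rewrite -pcE addn2 ltnS le.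
rewrite -[RHS]cardE -(card_imset _ vlI); apply: eq_card => m; rewrite !inE.
apply/andP/imsetP => [[/inPencil[->|[b ->]]]|[b + ->]].
- by rewrite l2; lia.
- by rewrite -pcE addn2 ltnS => rb; exists b; rewrite ?inE.
by rewrite inE -pcE addn2 ltnS.
Qed.
End Secants.

(** * Minimal double blocking sets in planes of square order *)

Section DoubleBlocking.
Local Open Scope nat_scope.
Variable F : finFieldType.
Local Notation q := #|F|.
Implicit Types (P Q : point F) (l m : line F) (A B S : {set point F}).

Let q1 : 1 < q. Proof. exact: finNzRing_gt1. Qed.

Lemma double_blockingP B : reflect (forall l, 2 <= npt B l) (double_blocking B).
Proof. exact: forallP. Qed.

Lemma nptE B l : npt B l = \sum_(P in B | incident P l) 1.
Proof. by rewrite sum1dep_card. Qed.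

Lemma sum_npt_pencil B P : P \notin B -> \sum_(l | incident P l) npt B l = #|B|.
Proof.
move=> PB; rewrite -[RHS]sum1_card [RHS]big_mkcond [RHS](bigD1 P) //= (negPf PB) add0n -sum_pencil.
apply: eq_bigr => l Pl; rewrite nptE [in RHS]big_mkcond [LHS]big_mkcond /=.
by apply: eq_bigr => Q _; case: eqVneq => [->|QP]; rewrite ?(negPf PB) //=; case: (Q \in B); case: incident.
Qed.

Lemma sum_npt B (L : {set line F}) :
  \sum_(l in L) npt B l = \sum_(P in B) #|[set l in L | incident P l]|.
Proof.
under eq_bigr do rewrite nptE.
rewrite (exchange_big_dep (mem B)) /= => [|l P _ /andP[]//]; apply: eq_bigr => P PB.
by rewrite sum1dep_card; apply: eq_card => l; rewrite !inE PB.
Qed.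

Lemma long_line_arith r c n : 10 < r -> c < 2 * r -> r + 2 <= n <= c + 2 ->
  (1 + n * r) * n = (2 * r ^ 2 + 2 + c) * r.+1 ->
  (1 + n * r) * (n - 2) <= 2 * r ^ 2 + c * r ^ 2 + c -> False.
Proof.
rewrite -!mulnn => r10 cr /andP[n1 n2] eq1 le1.
have H : n + r * (n * n) = c + 2 + r * (2 * (r * r) + 2 * r + 2 + c) by move: eq1; clear; nia.
(* [H] shows that [r] divides [c + 2 - n], which lies between [0] and [r - 1]. *)
have nE : n = c + 2.
  have E : c + 2 - n = r * (n * n - (2 * (r * r) + 2 * r + 2 + c)).
    by rewrite mulnBr; move: H n2; clear; move: (r * (n * n)) (r * (_ + c)); lia.
  have lt : c + 2 - n < r by move: cr n1; clear; lia.
  move: E lt; case: (n * n - _) => [|k].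
    by rewrite muln0; move: n2; clear; lia.
  by move=> ->; rewrite ltnNge mulnS leq_addr.
(* With [n = c + 2] the inequality reduces to [(c + 2) r c <= (c + 2) r ^ 2]; together with
   [r + 2 <= n] it forces [c = r], and the equation then fails. *)
have cr' : c <= r.
  have : (c + 2) * (r * c) <= (c + 2) * (r * r) by move: le1; rewrite nE addnK; clear; nia.
  rewrite !leq_mul2l addn2 /=; case/orP=> // /eqP r0; by rewrite r0 in r10.
have {}cr' : c = r by move: cr' n1; rewrite nE; clear; lia.
by move: eq1 r10; rewrite nE cr'; clear; nia.
Qed.

Section Minimal.
Variables (B : {set point F}) (r c : nat).
Hypothesis qE : q = r ^ 2.
Hypothesis r10 : 10 < r.
Hypothesis cr : c < 2 * r.
Hypothesis cB : #|B| = 2 * q + 2 + c.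
Hypothesis dbl : double_blocking B.
Hypothesis minB : forall P, P \in B -> ~~ double_blocking (B :\ P).

Let ge2 l : 2 <= npt B l. Proof. by move/double_blockingP: dbl; apply. Qed.

Let two_secant P : P \in B -> exists2 l, incident P l & npt B l = 2.
Proof.
move=> PB; have /forallPn[l] := minB PB; rewrite -ltnNge -/(npt _ l) npt_remove //.
have := ge2 l; case Pl: (incident P l) => /= g lt; exists l => //; lia.
Qed.

Let two_secants P : P \in B -> exists l l',
  [/\ incident P l, npt B l = 2, incident P l', npt B l' = 2 & l' != l].
Proof.
move=> PB; have [l Pl l2] := two_secant PB.
have [/existsP[l' /and3P[Pl' /eqP l'2 ll]]|no] :=
  boolP [exists l', [&& incident P l', npt B l' == 2 & l' != l]]; first by exists l, l'.
suff : 3 * q <= #|B| + 1 by rewrite cB qE; nia.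
apply: (unique_two_secant_card PB Pl l2) => // m Pm ml; rewrite ltn_neqAle ge2 andbT eq_sym.
by move/existsPn/(_ m): no; rewrite Pm ml andbT.
Qed.

Let long : {set line F} := [set l | r + 2 <= npt B l].

Let card_long_pencil P : P \in B -> #|[set l in long | incident P l]| = r.+1.
Proof.
move=> PB; have [l [l' [Pl l2 Pl' l'2 ll]]] := two_secants PB.
have [<- _] := long_secants_card qE r10 cr cB ge2 PB Pl l2 Pl' l'2 ll.
by apply: eq_card => m; rewrite !inE andbC.
Qed.

Let npt_long_le P l : P \in B -> incident P l -> npt B l <= c + 2.
Proof.
move=> PB; have [k [k' [Pk k2 Pk' k'2 kk]]] := two_secants PB.
by have [_] := long_secants_card qE r10 cr cB ge2 PB Pk k2 Pk' k'2 kk; apply.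
Qed.

Let long_meet l m P : l \in long -> m \in long -> l != m ->
  incident P l -> incident P m -> P \in B.
Proof.
rewrite !inE => ll lm nlm Pl Pm; apply: contraT => PB.
have := sum_npt_pencil PB; rewrite (bigD1 l) //= (bigD1 m) ?Pm 1?eq_sym //= cB.
have : \sum_(k | [&& incident P k, k != l & k != m]) 2 <=
       \sum_(k | (incident P k && (k != l)) && (k != m)) npt B k.
  by rewrite (eq_bigl _ _ (fun k => andbA _ _ _)); apply: leq_sum => k _; apply: ge2.
have -> : \sum_(k | [&& incident P k, k != l & k != m]) 2 = 2 * q.-1.
  rewrite sum_nat_const mulnC; congr (_ * _).
  have := card_pencil P; rewrite (cardsD1 l) (cardsD1 m) !inE Pl Pm eq_sym nlm.
  have -> : #|[set m0 | incident P m0] :\ l :\ m| = #|[pred k | [&& incident P k, k != l & k != m]]|.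
    by apply: eq_card => k; rewrite !inE; case: (k == l); case: (k == m); case: (incident P k).
  by move: (q) q1; clear; move: #|_|; lia.
by move: ll lm cr q1; clear; move: (\sum_(k | _) _); lia.
Qed.

(** Every other long line meets [l] in exactly one point, which lies in [B], and each point of [B]
    on [l] is on [r] further long lines. *)
Let card_long l : l \in long -> #|long| = 1 + npt B l * r.
Proof.
move=> ll; rewrite (cardsD1 l) ll; congr (_ + _).
have -> : npt B l * r = \sum_(P in [set P in B | incident P l]) #|[set m in long :\ l | incident P m]|.
  rewrite -sum_nat_const; apply: eq_bigr => P; rewrite inE => /andP[PB Pl].
  have := card_long_pencil PB; rewrite (cardsD1 l) inE ll Pl => -[<-].
  by apply: eq_card => m; rewrite !inE andbA.
rewrite -sum_npt -sum1_card; apply: eq_bigr => m; rewrite !inE => /andP[ml lm].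
have lm' : m \in long by rewrite inE.
have [P /andP[Pl Pm]] := meet_point l m.
have PB : P \in B by apply: long_meet Pl Pm => //; rewrite eq_sym.
apply/esym/eqP/cards1P; exists P; apply/setP => Q; rewrite !inE.
apply/andP/eqP => [[/andP[_ Ql] Qm]|->]; last by rewrite PB.
by apply: point_uniq Ql Qm Pl Pm; rewrite eq_sym.
Qed.

Lemma minimal_double_blocking_absurd : False.
Proof.
have [P PB] : exists P, P \in B by apply/card_gt0P; rewrite cB addnAC addn2.
have [l] : exists l, l \in [set l in long | incident P l].
  by apply/card_gt0P; rewrite card_long_pencil.
rewrite inE => /andP[ll Pl]; pose n := npt B l.
have nE m : m \in long -> npt B m = n.
  move=> lm; have := card_long ll; rewrite (card_long lm) => /eqP.
  by rewrite eqn_add2l eqn_pmul2r ?(leq_trans _ r10) // => /eqP.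
have eq1 : (1 + n * r) * n = (2 * r ^ 2 + 2 + c) * r.+1.
  rewrite -(card_long ll) -qE -cB -!sum_nat_const.
  rewrite -(eq_bigr _ card_long_pencil) -sum_npt; apply: eq_bigr => m lm; exact/esym/nE.
(* The right-hand side is the total excess over two, [#|B| (q + 1) - 2 (q ^ 2 + q + 1)]; the long
   lines account for only part of it. *)
have le1 : (1 + n * r) * (n - 2) <= 2 * r ^ 2 + c * r ^ 2 + c.
  have E : \sum_l npt B l = #|B| * q.+1.
    have -> : \sum_l npt B l = \sum_(l in setT) npt B l by apply: eq_bigl => m; rewrite inE.
    rewrite sum_npt -sum_nat_const; apply: eq_bigr => Q _; rewrite -(card_pencil Q).
    by apply: eq_card => m; rewrite !inE.
  have H : \sum_(m in long) (n - 2) + \sum_(m : line F) 2 <= \sum_l npt B l.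
    rewrite [X in X + _]big_mkcond -big_split /=; apply: leq_sum => m _.
    by case: ifP => [/nE E'|_]; have := ge2 m; rewrite ?E' //; clear; lia.
  move: H; rewrite E !sum_nat_const (card_long ll) card_lines cB -/n qE.
  by move: ((1 + n * r) * (n - 2)); clear; nia.
apply: long_line_arith r10 cr _ eq1 le1.
by rewrite /n (npt_long_le PB Pl) andbT; move: ll; rewrite inE.
Qed.
End Minimal.
End DoubleBlocking.

(** * Semi-resolving sets *)

Section Resolving.
Local Open Scope nat_scope.
Variable F : finFieldType.
Local Notation q := #|F|.
Implicit Types (P Q : point F) (l m : line F) (A B S X : {set point F}).

Let q1 : 1 < q. Proof. exact: finNzRing_gt1. Qed.

(** A point off [l] is joined by a line to a point of [l], so distance three always suffices.
    Distance lists thus carry the same information as traces on the set. *)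
Lemma dist_line_pointE l P : dist_line_point l P = if incident P l then 1 else 3.
Proof.
rewrite /dist_line_point /graph_dist; set w := walk_of_length _ _ _.
(* The search range contains the lengths [0] to [3], so [find] meets a walk before its default
   value. *)
have cT : #|{: point F + line F}| = (#|{: point F + line F}| - 4) + 4.
  by rewrite subnK // card_sum card_points; nia.
have w0 : w 0 = false by apply/existsP => -[p]; rewrite tuple0.
have w1 : w 1 = incident P l.
  apply/existsP/idP => [[p]|Pl]; last by exists [tuple inl P]; rewrite /= Pl eqxx.
  by case/tupleP: p => a p; rewrite tuple0 /= andbT => /andP[+ /eqP E]; rewrite E.
have w2 : w 2 = false.
  apply/existsP => -[p]; case/tupleP: p => a p; case/tupleP: p => b p; rewrite tuple0 /= andbT.
  by case/andP=> /andP[+ +] /eqP E; rewrite E; case: a.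
have w3 : w 3.
  have [Q Ql QP] : exists2 Q, incident Q l & Q != P.
    have : 0 < #|[set Q | incident Q l] :\ P|.
      have := cardsD1 P [set Q | incident Q l]; rewrite card_points_line.
      by case: (P \in _) => /= E; move: (q) q1 E; clear; lia.
    by case/card_gt0P => Q; rewrite !inE => /andP[]; exists Q.
  have [m Qm Pm] := join_line QP.
  by apply/existsP; exists [tuple inl Q; inr m; inl P]; rewrite /= Ql Qm Pm eqxx.
by rewrite cT addn4 /= w0 w1 w2 w3; case: ifP.
Qed.

Lemma semi_resolving_trace S l m : semi_resolving S ->
  (forall P, P \in S -> incident P l = incident P m) -> l = m.
Proof.
move=> resS E; apply: resS; rewrite /dist_list; apply/eq_in_map => P.
by rewrite mem_enum !dist_line_pointE => /E->.
Qed.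

Lemma npt_add S P l : P \notin S -> npt (P |: S) l = npt S l + incident P l.
Proof.
move=> PS; have := npt_remove l (setU11 P S); rewrite setU1K // => ->.
have : incident P l <= npt (P |: S) l.
  by case Pl: (incident P l) => //; apply/card_gt0P; exists P; rewrite !inE eqxx.
by move/subnK.
Qed.

Lemma npt_sub A B l : A \subset B -> npt A l <= npt B l.
Proof.
move=> /subsetP AB; apply/subset_leq_card/subsetP => P; rewrite !inE.
by case/andP=> /AB-> ->.
Qed.

Lemma npt_skew S l P : npt S l = 0 -> P \in S -> incident P l = false.
Proof.
move/eqP; rewrite cards_eq0 => /eqP/setP/(_ P); rewrite !inE => + PS.
by rewrite PS.
Qed.

Lemma npt_tangent S l P Q : npt S l = 1 -> P \in S -> incident P l -> Q \in S ->
  incident Q l = (Q == P).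
Proof.
move/eqP/cards1P => [T /setP E] PS Pl QS.
have := E P; have := E Q; rewrite !inE PS Pl QS /= => -> /esym/eqP ->.
by [].
Qed.

Lemma extend_subset (T : finType) (A C : {set T}) k : A \subset C -> #|A| <= k <= #|C| ->
  exists X : {set T}, [/\ A \subset X, X \subset C & #|X| = k].
Proof.
move=> AC /andP[Ak kC]; rewrite -(subnKC Ak) in kC *.
elim: (k - #|A|) kC => [|j IH] kC; first by exists A; rewrite addn0.
have [|X [AX XC cX]] := IH; first by apply: leq_trans kC; rewrite addnS.
have /properP[_ [x xC xX]] : X \proper C by rewrite properEcard XC cX -addnS.
exists (x |: X); split; first exact: subset_trans AX (subsetUr _ _).
  by rewrite subUset sub1set xC.
by rewrite cardsU1 xX cX addnS.
Qed.

Section Extension.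
Variable S : {set point F}.
Hypothesis resS : semi_resolving S.
Hypothesis q3 : 3 <= q.
Local Notation n := #|S|.
Local Notation dfc := (deficiency S).
Hypothesis small : 4 * n + 12 < 9 * q.

Let t := \sum_l dfc l.
Let ind P := \sum_(m | incident P m) dfc m.

Let skew_uniq l m : npt S l = 0 -> npt S m = 0 -> l = m.
Proof. by move=> l0 m0; apply: semi_resolving_trace resS _ => P PS; rewrite !(@npt_skew S). Qed.

Let tangent_uniq l m P : P \in S -> incident P l -> incident P m ->
  npt S l = 1 -> npt S m = 1 -> l = m.
Proof.
move=> PS Pl Pm l1 m1; apply: semi_resolving_trace resS _ => Q QS.
by rewrite (npt_tangent l1 PS Pl QS) (npt_tangent m1 PS Pm QS).
Qed.

Let tangents : {set line F} := [set l | npt S l == 1].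
Let skews : {set line F} := [set l | npt S l == 0].

Let card_tangents : #|tangents| <= n.
Proof.
have -> : #|tangents| = \sum_(l in tangents) npt S l.
  by rewrite -sum1_card; apply: eq_bigr => l; rewrite inE => /eqP.
rewrite sum_npt -[n]sum1_card; apply: leq_sum => P PS.
apply/card_le1_eqP => l m; rewrite !inE => /andP[/eqP l1 Pl] /andP[/eqP m1 Pm].
exact: tangent_uniq PS Pm Pl m1 l1.
Qed.

Let t_eq : t = #|tangents| + 2 * #|skews|.
Proof.
rewrite mulnC -[in RHS]sum1_card -sum_nat_const big_mkcond [X in _ + X]big_mkcond -big_split /=.
apply: eq_bigr => l _; rewrite !inE /deficiency.
by case: (npt S l) => [|[|k]].
Qed.

Let card_skews : #|skews| <= 1.
Proof.
by apply/card_le1_eqP => l m; rewrite !inE => /eqP l0 /eqP m0; exact: skew_uniq m0 l0.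
Qed.

Let t_le : t <= n + 2.
Proof. by rewrite t_eq; move: card_tangents card_skews; clear; lia. Qed.

(** Counting incidences gives [2 (q ^ 2 + q + 1) <= n (q + 1) + t]. The bound ensures a secant
    through each point outside [S], as required by [index_lemma]. *)
Let n_big : q + 1 < n.
Proof.
have E : \sum_l npt S l = n * q.+1.
  have -> : \sum_l npt S l = \sum_(l in setT) npt S l by apply: eq_bigl => m; rewrite inE.
  rewrite sum_npt -sum_nat_const; apply: eq_bigr => Q _; rewrite -(card_pencil Q).
  by apply: eq_card => m; rewrite !inE.
have H : \sum_(l : line F) 2 <= \sum_l npt S l + t.
  by rewrite -big_split; apply: leq_sum => l _; rewrite /deficiency /=; clear; lia.
move: H t_le q3; rewrite E sum_nat_const card_lines; move: t n (q); clear; nia.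
Qed.

Let index_bound_S P : P \notin S -> 3 * q * ind P <= t + ind P * (ind P + n).
Proof.
move=> PS.
have [/existsP[l /andP[Pl l2]]|/existsPn no] := boolP [exists l, incident P l && (2 <= npt S l)].
  exact: index_lemma PS Pl l2.
have : \sum_(l | incident P l) npt S l <= \sum_(l | incident P l) 1.
  by apply: leq_sum => l Pl; have := no l; rewrite Pl -ltnNge.
by rewrite sum_npt_pencil // sum1dep_card card_pencil leqNgt -addn1 n_big.
Qed.

(** With [t <= n + 2], the quadratic [i ^ 2 - (3 q - n) i + n + 2] has the same value
    [4 n + 11 - 9 q] at [3] and at [3 q - n - 3]. By [small] it is negative there, hence on the
    whole interval between. *)
Let ind_gap P : P \notin S -> 3 <= ind P -> 3 * q <= ind P + n + 2.
Proof.
move=> PS i3; rewrite leqNgt; apply/negP => lt; have := leq_trans (index_bound_S PS) (leq_add t_le (leqnn _)).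
by move: (ind P) i3 lt small; clear; move: n (q) => N Q i i3 lt sm; nia.
Qed.

Let ind_two P : P \notin S -> t <= q + 1 -> ind P != 2.
Proof.
move=> PS tq; apply/eqP => i2; have := index_bound_S PS; rewrite i2.
by move: tq small; clear; move: n t (q) => N T Q; lia.
Qed.

Let large : {set point F} := [set P | P \notin S & 3 <= ind P].

Lemma sum_index (W : {set point F}) :
  \sum_(P in W) ind P = \sum_l dfc l * npt W l.
Proof.
rewrite (exchange_big_dep xpredT) //=; apply: eq_bigr => l _.
by rewrite sum_nat_const mulnC; congr (_ * _); apply: eq_card => P; rewrite !inE.
Qed.

(** Three large indices add up to at least [3 (3 q - n - 2)]; a sum of at most [n + 6] would give
    [9 q <= 4 n + 12], against [small]. *)
Let large_triple (W : {set point F}) : W \subset large -> #|W| = 3 ->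
  \sum_l dfc l * npt W l <= n + 6 -> False.
Proof.
move=> /subsetP Wl cW; rewrite -sum_index => le.
have : \sum_(P in W) (3 * q) <= \sum_(P in W) (ind P + (n + 2)).
  by apply: leq_sum => P /Wl; rewrite inE addnA => /andP[]; exact: ind_gap.
rewrite sum_nat_const big_split /= sum_nat_const cW.
by move: le small; clear; move: (\sum_(P in W) _) n (q) => X N Q; lia.
Qed.

Let subset3 (W : {set point F}) : 2 < #|W| -> exists2 V : {set point F}, V \subset W & #|V| = 3.
Proof.
move=> W3; have [||V [_ VW cV]] := @extend_subset _ set0 W 3; rewrite ?sub0set ?cards0 //.
by exists V.
Qed.

(* A deficient line m other than a skew line l meets l in a large point, so the
   large points of l and possibly further points of l suffice. *)
Let extension_skew l : npt S l = 0 -> exists2 X : {set point F}, #|X| <= 2 & double_blocking (S :|: X).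
Proof.
move=> l0; pose L := [set P | incident P l].
have dl : dfc l = 2 by rewrite /deficiency l0.
have L2 : #|large :&: L| <= 2.
  rewrite leqNgt; apply/negP => /subset3[V /subsetP VL cV]; apply: (large_triple (W := V)) => //.
    by apply/subsetP => P /VL; rewrite inE => /andP[].
  (* The line [l] contributes [2 * 3 = 2 + 4], any other line meets [V] at most once, so the total
     is at most [t + 4 <= n + 6]. *)
  have Vm m : dfc m * npt V m <= dfc m + (if m == l then 4 else 0).
    case: eqVneq => [->|ml].
      by rewrite dl; have : npt V l <= #|V|; [apply: subset_leq_card; apply/subsetP => P; rewrite inE => /andP[] | rewrite cV; clear; lia].
    rewrite addn0 -[X in _ <= X]muln1 leq_mul2l; apply/orP; right.
    apply/card_le1_eqP => P Q; rewrite !inE => /andP[/VL + Pm] /andP[/VL + Qm].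
    rewrite !inE => /andP[_ Pl] /andP[_ Ql]; exact: point_uniq ml Qm Ql Pm Pl.
  apply: (@leq_trans (\sum_m (dfc m + (if m == l then 4 else 0)))); first exact: leq_sum.
  rewrite big_split /= -big_mkcond big_pred1_eq.
  by rewrite -[6]/(2 + 4) addnA leq_add2r; exact: t_le.
(* Padding to exactly two points of [l] makes [l] itself doubly blocked. *)
have [X [LX XL cX]] : exists X, [/\ large :&: L \subset X, X \subset L & #|X| = 2].
  by apply: extend_subset; rewrite ?subsetIr // L2 card_points_line ltnS ltnW.
exists X; first by rewrite cX.
apply/double_blockingP => m; have [->|ml] := eqVneq m l.
  apply: leq_trans (npt_sub _ (subsetUr S X)); rewrite -cX; apply: subset_leq_card.
  apply/subsetP => P PX; rewrite inE PX /=.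
  by move/subsetP/(_ P PX): XL; rewrite inE.
have [m2|m2] := leqP 2 (npt S m); first exact: leq_trans m2 (npt_sub _ (subsetUl S X)).
have m1 : npt S m = 1.
  case: (npt S m) m2 (skew_uniq l0 (m := m)) => [|[|//]] // _ /(_ erefl) E.
  by rewrite E eqxx in ml.
have [P /andP[Pm Pl]] := meet_point m l.
have PS : P \notin S by apply: contraT => /negPn PS; rewrite (npt_skew l0 PS) in Pl.
(* The index of [P] is at least [2 + 1], from [l] and [m]. *)
have PX : P \in X.
  apply: (subsetP LX); rewrite !inE Pl PS andbT /= /ind (bigD1 l) //= (bigD1 m) /=; last by rewrite Pm.
  by rewrite dl /deficiency m1 addnA leq_addr.
apply: (@leq_trans (npt (P |: S) m)); first by rewrite npt_add // m1 Pm.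
by apply: npt_sub; rewrite subUset sub1set subsetUl inE PX orbT.
Qed.

(** If every tangent contains a large point, the large points are added. Otherwise, counting indices
    along a tangent without large points shows that it is the only tangent, and one point
    suffices. *)
Let extension_no_skew : (forall l, 0 < npt S l) ->
  exists2 X : {set point F}, #|X| <= 2 & double_blocking (S :|: X).
Proof.
move=> noskew.
have d1 l : dfc l <= 1 by have := noskew l; rewrite /deficiency; clear; lia.
have tn : t <= n.
  rewrite t_eq; have -> : skews = set0.
    by apply/setP => l; rewrite !inE; have := noskew l; case: (npt S l).
  by rewrite cards0 addn0.
have [/forallP all|/forallPn[l]] :=
  boolP [forall l, (npt S l == 1) ==> [exists P, (P \in large) && incident P l]].
  exists large.
    rewrite leqNgt; apply/negP => /subset3[W WL cW]; apply: (large_triple WL cW).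
    (* Counts ordered pairs of distinct points of [W] by their joining line. Since
       [k <= 1 + k (k - 1)], the index sum over [W] is at most [t + 6]. *)
    have E : \sum_m npt W m * (npt W m).-1 = 6.
      transitivity (\sum_(P in W) \sum_(m | incident P m) npt (W :\ P) m).
        rewrite (exchange_big_dep xpredT) //=; apply: eq_bigr => m _.
        rewrite (eq_bigr (fun=> (npt W m).-1)) => [|P /andP[PW Pm]].
          by rewrite sum_nat_const; congr (_ * _); apply: eq_card => P; rewrite !inE.
        by rewrite npt_remove // Pm subn1.
      rewrite (eq_bigr (fun=> 2)) => [|P PW]; first by rewrite sum_nat_const cW.
      rewrite sum_npt_pencil ?setD11 //; apply: succn_inj.
      by rewrite -cW (cardsD1 P W) PW.
    apply: (@leq_trans (t + \sum_m npt W m * (npt W m).-1)); last by rewrite E leq_add2r.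
    rewrite -big_split /=; apply: leq_sum => m _; have := d1 m.
    by move: (dfc m) (npt W m); clear; move=> [|[|]] // [|k] _; rewrite ?muln0 ?mul1n ?addn0 // -[k.+1]add1n leq_add2l leq_pmull.
  apply/double_blockingP => l.
  have [m2|m2] := leqP 2 (npt S l); first exact: leq_trans m2 (npt_sub _ (subsetUl S _)).
  have l1 : npt S l = 1 by have := noskew l; move: m2; clear; lia.
  have := all l; rewrite l1 /= => /existsP[P /andP[PL Pl]].
  have PS : P \notin S by move: PL; rewrite inE => /andP[].
  apply: (@leq_trans (npt (P |: S) l)); first by rewrite npt_add // l1 Pl.
  by apply: npt_sub; rewrite subUset sub1set subsetUl inE PL orbT.
rewrite negb_imply => /andP[/eqP l1 /existsPn nolarge].
have [R RS Rl] : exists2 R, R \in S & incident R l.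
  have : 0 < npt S l by rewrite l1.
  by case/card_gt0P => R; rewrite inE => /andP[]; exists R.
have offS P : incident P l -> P != R -> P \notin S.
  by move=> Pl PR; apply/negP => PS; have := npt_tangent l1 RS Rl PS; rewrite Pl (negPf PR).
pose W := [set P | incident P l] :\ R.
have cW : #|W| = q.
  by have := cardsD1 R [set P | incident P l]; rewrite card_points_line inE Rl add1n => -[].
have le2 P : P \in W -> ind P <= 2.
  rewrite !inE => /andP[PR Pl]; have := nolarge P; rewrite inE Pl andbT (offS P) //=.
  by rewrite -ltnNge.
(* The tangent [l] is counted at each of the [q] points of [W], and every other tangent once: it
   meets [l] outside [S], as [R] has only one tangent. *)
have sumW : \sum_(P in W) ind P = q + (t - 1).
  have d_l : dfc l = 1 by rewrite /deficiency l1.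
  rewrite sum_index /t (bigD1 l) //= [in RHS](bigD1 l) //= d_l addKn mul1n; congr (_ + _).
    by rewrite -cW; apply: eq_card => P; rewrite !inE; case: (incident P l); rewrite ?andbT ?andbF.
  apply: eq_bigr => m ml; case: (posnP (dfc m)) => [->//|dm].
  have m1 : npt S m = 1 by have := noskew m; move: dm; rewrite /deficiency; clear; lia.
  suff -> : npt W m = 1 by rewrite muln1.
  have [T /andP[Tm Tl]] := meet_point m l.
  have TR : T != R.
    by apply: contraNneq ml => TR; apply/eqP; apply: tangent_uniq RS _ Rl m1 l1; rewrite -TR.
  apply/eqP/cards1P; exists T; apply/setP => P; rewrite !inE.
  apply/andP/eqP => [[/andP[_ Pl] Pm]|->]; last by rewrite TR Tl.
  exact: point_uniq ml Pm Pl Tm Tl.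
(* Indices at most two give [t <= q + 1]; then [ind_two] excludes index two, and indices at most one
   give [t <= 1]. *)
have tq : t <= q + 1.
  have : \sum_(P in W) ind P <= \sum_(P in W) 2 by apply: leq_sum.
  by rewrite sumW sum_nat_const cW; move: (q) t; clear; lia.
have le1 P : P \in W -> ind P <= 1.
  move=> PW; have := le2 P PW; rewrite leq_eqVlt => /orP[|//].
  have PS : P \notin S by move: PW; rewrite !inE => /andP[PR Pl]; apply: offS.
  by rewrite (negPf (ind_two PS tq)).
have t1 : t <= 1.
  have : \sum_(P in W) ind P <= \sum_(P in W) 1 by apply: leq_sum.
  by rewrite sumW sum_nat_const cW; move: (q) t; clear; lia.
have [P PW] : exists P, P \in W by apply/card_gt0P; rewrite cW ltnW.
have [PR Pl] : P != R /\ incident P l by move: PW; rewrite !inE => /andP[].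
exists [set P]; first by rewrite cards1.
apply/double_blockingP => m; rewrite setUC npt_add ?offS //.
have := t1; rewrite /t (bigD1 l) //= {1}/deficiency l1.
have [->|ml] := eqVneq m l; first by rewrite l1 Pl.
rewrite (bigD1 m) //= /deficiency; case: (npt S m) => [|[|k]] //=; by rewrite ?addn2.
Qed.

Lemma double_blocking_extension : exists2 X : {set point F}, #|X| <= 2 & double_blocking (S :|: X).
Proof.
have [/existsP[l /eqP l0]|/existsPn no] := boolP [exists l, npt S l == 0].
  exact: extension_skew l0.
by apply: extension_no_skew => l; rewrite lt0n no.
Qed.
End Extension.

Lemma tau2_le B : double_blocking B -> tau2 F <= #|B|.
Proof. by move=> dB; rewrite /tau2; case: arg_minnP => [|X _]; [exact: double_blockingT | apply]. Qed.

Lemma semi_resolving_card S : semi_resolving S -> 3 <= q ->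
  9 * q <= 4 * #|S| + 12 \/ tau2 F <= #|S| + 2.
Proof.
move=> resS q3; have [|small] := leqP; [by left | right].
have [X X2 dX] := double_blocking_extension resS q3 small.
apply: leq_trans (tau2_le dX) _; rewrite cardsU.
by apply: leq_trans (leq_subr _ _) _; rewrite leq_add2l.
Qed.

Lemma tau2_square r : q = r ^ 2 -> 10 < r -> 2 * q + 2 * r + 2 <= tau2 F.
Proof.
move=> qE r10; rewrite /tau2; case: arg_minnP => [|B dB minB]; first exact: double_blockingT.
rewrite leqNgt; apply/negP => lt.
have [P PB] : exists P, P \notin B.
  apply/existsP; rewrite -negb_forall; apply/negP => /forallP all.
  have BT : B = setT by apply/setP => P; rewrite inE all.
  by move: lt; rewrite BT cardsT card_points qE; clear -r10; nia.
(* Makes the truncated subtraction defining [c] exact below. *)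
have Bge : 2 * q + 2 <= #|B|.
  rewrite -(sum_npt_pencil PB).
  have -> : 2 * q + 2 = \sum_(l | incident P l) 2.
    rewrite sum_nat_const -[#|_|]/(#|[pred l | incident P l]|).
    have := card_pencil P; rewrite cardsE => ->; by rewrite [q.+1 * 2]mulnC mulnS addnC.
  by apply: leq_sum => l _; move/double_blockingP: dB; apply.
apply: (minimal_double_blocking_absurd (B := B) (c := #|B| - (2 * q + 2)) qE r10) => //.
- by move: lt Bge; clear; lia.
- by rewrite subnKC.
by move=> Q QB; apply/negP => /minB; rewrite (cardsD1 Q B) QB add1n ltnn.
Qed.
End Resolving.

Theorem theorem2 (R : rcfType) (F : finFieldType) (q : nat) (hq : #|F| = q)
    (q_ge3 : (3 <= q)%N) (S : {set point F}) (hS : semi_resolving S) :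
  Num.min (2 * q%:R + q%:R / 4 - 3) ((tau2 F)%:R - 2) <= #|S|%:R :> R
  /\ ((121 <= q)%N -> (exists r : nat, q = (r ^ 2)%N) ->
      2 * q%:R + 2 * Num.sqrt q%:R <= #|S|%:R :> R).
Proof.
have q3 : (3 <= #|F|)%N by rewrite hq.
have dich := semi_resolving_card hS q3; rewrite hq in dich.
split.
  rewrite ge_min; case: dich => [le|le]; apply/orP; [left|right].
    have : (9 * q)%:R <= (4 * #|S| + 12)%:R :> R by rewrite ler_nat.
    by rewrite natrD !natrM => H; lra.
  have : (tau2 F)%:R <= (#|S| + 2)%:R :> R by rewrite ler_nat.
  by rewrite natrD lerBlDr.
move=> q121 [r qE].
have r10 : (10 < r)%N by move: q121; rewrite qE; clear; nia.
have -> : Num.sqrt q%:R = r%:R :> R by rewrite qE natrX sqrtr_sqr ger0_norm // ler0n.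
rewrite -!natrM -natrD ler_nat.
(* In the first case it suffices that [r ^ 2 >= 8 r + 12], which holds for [r > 10]. *)
case: dich => [le|le].
  by move: le r10; rewrite qE -mulnn; move: (#|S|); clear; nia.
have := leq_trans (tau2_square (etrans hq qE) r10) le.
by rewrite hq; move: (#|S|); clear; lia.
Qed.
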